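(* Let $\Gamma:\pi\to\pi'$ be a reduction sequence between proof nets with single conclusion $A$, and view $P_{\pi'}$ as a subring of $P_\pi$ via $T_\Gamma$. Then there is an equality of sets $$G^{(0)}_{\pi'}=\mathbb{B}_{es}\big(G^{(\Gamma)}_\pi,<_\Gamma\big)\cap P_{\pi'} .$$
   Context: **Formulas.** There is an infinite set of unoriented atoms $X,Y,\dots$; an oriented atom is a pair $(X,+)$ or $(X,-)$; $\bar +=-$, $\bar -=+$. Pre-formulas are generated from oriented atoms by $A\otimes B$, $A\wp B$ (par) and $\neg A$. Formulas are pre-formulas modulo the equivalence generated by $\neg(A\otimes B)=\neg B\wp\neg A$, $\neg(A\wp B)=\neg B\otimes\neg A$, $\neg(X,x)=(X,\bar x)$. The sequence of oriented atoms $a(A)$ is determined by: $a((X,x))$ is the one-term sequence $(X,x)$; $a(A\otimes B)=a(A\wp B)$ is the concatenation of $a(A)$ and $a(B)$; $a(\neg A)$ is $a(A)$ reversed with all signs flipped. The set of unoriented atoms $U_A$ has one element for each position of $a(A)$ (repeated atoms give distinct elements); an element is positive/negative according to the sign at that position. **Proof structures.** A proof structure is a directed multigraph with edges labelled by formulas and vertices labelled $\mathrm{ax},\mathrm{cut},\otimes,\wp,\mathrm c$, where incoming edges of a vertex are its premises and outgoing edges its conclusions, such that: an $\mathrm{ax}$ vertex has no premise and two conclusions labelled $A,\neg A$; a $\mathrm{cut}$ vertex has two premises labelled $A,\neg A$ and no conclusion; a $\otimes$ (resp. $\wp$) vertex has two ordered premises labelled $A$ (left), $B$ (right) and one conclusion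 labelled $A\otimes B$ (resp. $A\wp B$); a $\mathrm c$ vertex has one premise and no conclusion, and its premise is called a conclusion of the proof structure. Links are the vertices not labelled $\mathrm c$. A proof net is a proof structure that is the translation of a multiplicative linear logic sequent calculus proof: i.e. it lies in the least class containing an axiom link whose two conclusions go to $\mathrm c$ vertices, and closed under: joining two disjoint members by a $\otimes$ link applied to a conclusion of each (with a new conclusion $A\otimes B$), joining two disjoint members by a cut link applied to conclusions $A$ of one and $\neg A$ of the other, and applying a $\wp$ link to two distinct conclusions of one member. It has single conclusion $A$ if there is exactly one $\mathrm c$ vertex, with premise labelled $A$. **Polynomial ring and generators.** Fix a field $k$. $U_\pi$ is the disjoint union over edges $e$ of $\pi$ of the sets $U_{A_e}$, $A_e$ the label of $e$. $P_\pi$ is the polynomial ring over $k$ on $U_\pi$. For an ax or cut link $l$ with incident edges labelled $A,\neg A$, if $X_1,\dots,X_n$ are the atoms of $A$ in order and $X_i'\in U_{\neg A}$ is the matching occurrence (at position $n+1-i$), then $G_l=\{X_i-X'_i\}_{i}$. For a $\otimes$ or $\wp$ link with premise atoms $X_1,\dots,X_n$ (left) and $Y_1,\dots,Y_m$ (right) and conclusion atoms $X'_1,\dots,X'_n,Y'_1,\dots,Y'_m$ in order, $G_l=\{X_i-X_i'\}_i\cup\{Y_j-Y'_j\}_j$. $G_\pi=\bigcup_l G_l$ over all links. **Reductions.** An $a$-redex is a cut link with premises $e_1$ (labelled $A$) and $e_2$ (labelled $\neg A$), where $e_2$ is a conclusion of an ax link whose other conclusion is an edge $e_3\ne e_1$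 labelled $A$; reducing it deletes the cut and ax links and $e_1,e_2,e_3$ and inserts one edge $e$ labelled $A$ from the source of $e_1$ to the target of $e_3$ (in the premise position of $e_3$). An $m$-redex is a cut link whose premises are the conclusion of a $\otimes$ link (premises $e_A,e_B$ labelled $A,B$, conclusion labelled $A\otimes B$) and the conclusion of a $\wp$ link (premises $e_{\neg B},e_{\neg A}$ labelled $\neg B,\neg A$); reducing it deletes these three links and the edges labelled $A\otimes B$ and $\neg B\wp\neg A$ and inserts two cut links, one with premises $e_A,e_{\neg A}$ and one with premises $e_B,e_{\neg B}$. A reduction $\gamma:\pi\to\pi'$ is a redex in $\pi$ whose reduction yields $\pi'$. The $k$-algebra map $T_\gamma:P_{\pi'}\to P_\pi$ sends atoms on the new edge $e$ ($a$-redex) to the corresponding atoms on $e_3$, and all other atoms (including those of $e_A,e_B,e_{\neg A},e_{\neg B}$ for an $m$-redex) to themselves. A reduction sequence $\Gamma:\pi=\pi_1\xrightarrow{\gamma_1}\cdots\xrightarrow{\gamma_{n-1}}\pi_n=\pi'$ is a nonempty sequence of reductions, and $T_\Gamma=T_{\gamma_1}\circ\cdots\circ T_{\gamma_{n-1}}$ (injective). **Persistent paths and orders.** For $U,V\in U_\pi$ write $U\sim V$ if $U-V\in G_\pi$ or $V-U\in G_\pi$; let $\approx$ be the equivalence relation generated by $\sim$. For a proof net with single conclusion $A$ each $\approx$-class is the underlying set of a sequence (persistent path) $(Z_1,\dots,Z_r)$ with $Z_i\sim Z_{i+1}$, $Z_1$ a negative and $Z_r$ a positive atom of the conclusion edge.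 Order the persistent paths $\mathscr P_1,\dots,\mathscr P_m$ so that their last atoms appear in this order in $A$. $<_0$ is the total order on $U_\pi$ given by the concatenated sequence $\mathscr P_1,\dots,\mathscr P_m$ (earlier is smaller). Let $\mathscr Q_i$ be the subsequence of $\mathscr P_i$ of atoms in the image of $T_\Gamma$ and $\mathscr P_i\setminus\mathscr Q_i$ the complementary subsequence; $<_\Gamma$ is the total order on $U_\pi$ given by the sequence $\mathscr Q_1,\dots,\mathscr Q_m,\mathscr P_1\setminus\mathscr Q_1,\dots,\mathscr P_m\setminus\mathscr Q_m$ (earlier is smaller). The same symbols denote the lexicographic monomial orders determined by these orders on variables. Define $G^{(0)}_{\pi}=\{V-U: U,V\in U_\pi, U\sim V, U<_0V\}$ (and likewise for $\pi'$, with its own $<_0$) and $G^{(\Gamma)}_\pi=\{V-U: U,V\in U_\pi, U\sim V, U<_\Gamma V\}$. The latter is totally ordered: $V-U$ precedes $V'-U'$ if $V<_\Gamma V'$, or $V=V'$ and $U<_\Gamma U'$. **Buchberger with early stopping.** Division with early stopping of $f$ by $(f_1,\dots,f_s)$: set $p=f$, $q_i=0$, $r=0$; while $p\ne0$: if some $\mathrm{LT}(f_i)$ divides $\mathrm{LT}(p)$, for the least such $i$ replace $q_i$ by $q_i+\mathrm{LT}(p)/\mathrm{LT}(f_i)$ and $p$ by $p-(\mathrm{LT}(p)/\mathrm{LT}(f_i))f_i$; otherwise set $r=p$ and then $p=0$. Let $\mathrm{div}_{es}(f,G)=r$ for the final $r$. For a sequence $F=(f_1,\dots,f_s)$ and a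 monomial order $<$, $\mathbb B_{es}(F,<)$ is the output $G$ of: start with $G=F$, $t=s$, $B=\{(i,j):1\le i<j\le s\}$. While $B\neq\emptyset$: let $(i,j)$ be lexicographically first in $B$; if $\mathrm{LCM}(\mathrm{LM}(f_i),\mathrm{LM}(f_j))\neq \mathrm{LM}(f_i)\mathrm{LM}(f_j)$ and $\mathrm{Criterion}(f_i,f_j,B)$ is false, compute $S=\mathrm{div}_{es}(S(f_i,f_j),G)$ (where $S(f_i,f_j)=\frac{L}{\mathrm{LT}(f_i)}f_i-\frac{L}{\mathrm{LT}(f_j)}f_j$, $L=\mathrm{LCM}(\mathrm{LM}(f_i),\mathrm{LM}(f_j))$), and if $S\ne0$ increase $t$ by one, set $f_t=S/\mathrm{LC}(S)$, append $f_t$ to $G$ and add $(i',t)$, $1\le i'\le t-1$, to $B$; in all cases then remove $(i,j)$ from $B$. Here $\mathrm{Criterion}(f_i,f_j,B)$ is true if there is $l\notin\{i,j\}$ such that the pairs $[i,l]$ and $[j,l]$ (sorted increasingly) are not in $B$ and $\mathrm{LM}(f_l)$ divides $\mathrm{LCM}(\mathrm{LM}(f_i),\mathrm{LM}(f_j))$. *)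

(* Defs.v *)
From HB Require Import structures.
From mathcomp Require Import all_boot all_algebra.
From mathcomp.multinomials Require Import mpoly.

Set Implicit Arguments.
Unset Strict Implicit.
Unset Printing Implicit Defensive.

Import GRing.Theory.
Local Open Scope ring_scope.

(* [At] is the type of unoriented atoms; the sign [+] is [true]. *)
Inductive preformula (At : Type) : Type :=
  | PAtom (X : At) (x : bool)
  | PTens (A B : preformula At)
  | PPar (A B : preformula At)
  | PNeg (A : preformula At).

Inductive form_equiv (At : Type) : preformula At -> preformula At -> Prop :=
  | fe_tens A B : form_equiv (PNeg (PTens A B)) (PPar (PNeg B) (PNeg A))
  | fe_par A B : form_equiv (PNeg (PPar A B)) (PTens (PNeg B) (PNeg A))
  | fe_atom X x : form_equiv (PNeg (PAtom X x)) (PAtom X (~~ x))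
  | fe_refl A : form_equiv A A
  | fe_sym A B : form_equiv A B -> form_equiv B A
  | fe_trans A B C : form_equiv A B -> form_equiv B C -> form_equiv A C
  | fe_congT A A' B B' : form_equiv A A' -> form_equiv B B' ->
      form_equiv (PTens A B) (PTens A' B')
  | fe_congP A A' B B' : form_equiv A A' -> form_equiv B B' ->
      form_equiv (PPar A B) (PPar A' B')
  | fe_congN A A' : form_equiv A A' -> form_equiv (PNeg A) (PNeg A').

(* The quotient of [preformula At] by [form_equiv], realised by negation normal
   forms: [formula_of] is the projection (see [formula_ofP], [formula_of_surj]). *)
Inductive formula (At : Type) : Type :=
  | FAtom (X : At) (x : bool)
  | FTens (A B : formula At)
  | FPar (A B : formula At).

Fixpoint fneg (At : Type) (A : formula At) : formula At :=
  match A with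
  | FAtom X x => FAtom X (~~ x)
  | FTens A B => FPar (fneg B) (fneg A)
  | FPar A B => FTens (fneg B) (fneg A)
  end.

Fixpoint formula_of (At : Type) (p : preformula At) : formula At :=
  match p with
  | PAtom X x => FAtom X x
  | PTens A B => FTens (formula_of A) (formula_of B)
  | PPar A B => FPar (formula_of A) (formula_of B)
  | PNeg A => fneg (formula_of A)
  end.

Fixpoint preformula_of (At : Type) (A : formula At) : preformula At :=
  match A with
  | FAtom X x => PAtom X x
  | FTens A B => PTens (preformula_of A) (preformula_of B)
  | FPar A B => PPar (preformula_of A) (preformula_of B)
  end.

Fixpoint atoms (At : Type) (A : formula At) : seq (At * bool) :=
  match A with
  | FAtom X x => [:: (X, x)]
  | FTens A B => atoms A ++ atoms B
  | FPar A B => atoms A ++ atoms B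
  end.

Lemma fnegK (At : Type) : involutive (@fneg At).
Proof. by elim=> [X x|A IA B IB|A IA B IB] /=; rewrite ?negbK ?IA ?IB. Qed.

Lemma formula_of_surj (At : Type) : cancel (@preformula_of At) (@formula_of At).
Proof. by elim=> [X x|A IA B IB|A IA B IB] //=; rewrite IA IB. Qed.

Lemma preformula_of_neg (At : Type) (A : formula At) :
  form_equiv (PNeg (preformula_of A)) (preformula_of (fneg A)).
Proof.
elim: A => [X x|A IA B IB|A IA B IB] /=; first exact: fe_atom.
- by apply: fe_trans (fe_tens _ _) _; apply: fe_congP.
- by apply: fe_trans (fe_par _ _) _; apply: fe_congT.
Qed.

Lemma formula_ofK (At : Type) (p : preformula At) :
  form_equiv p (preformula_of (formula_of p)).
Proof.
elim: p => [X x|A IA B IB|A IA B IB|A IA] /=; first exact: fe_refl.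
- exact: fe_congT.
- exact: fe_congP.
- by apply: fe_trans (fe_congN IA) _; apply: preformula_of_neg.
Qed.

Lemma formula_ofP (At : Type) (p q : preformula At) :
  form_equiv p q <-> formula_of p = formula_of q.
Proof.
split=> [|e]; last first.
  by apply: fe_trans (formula_ofK p) _; rewrite e; apply/fe_sym/formula_ofK.
by elim=> //= *; congruence.
Qed.

Lemma atoms_neg (At : Type) (A : formula At) :
  atoms (fneg A) = rev [seq (Xx.1, ~~ Xx.2) | Xx <- atoms A].
Proof.
by elim: A => [X x|A IA B IB|A IA B IB] //=; rewrite IA IB map_cat rev_cat.
Qed.

Inductive vlabel : Type := Vax | Vcut | Vtens | Vpar | Vc.

Definition vlabel_eq_dec (x y : vlabel) : {x = y} + {x <> y}.
Proof. by decide equality. Defined.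

HB.instance Definition _ := hasDecEq.Build vlabel (compareP vlabel_eq_dec).

(* Tensor and par vertices are those with ordered premises. *)
Definition ordered_label (x : vlabel) : bool := (x == Vtens) || (x == Vpar).

(* Labelled directed multigraphs. [isleft e] says that [e] is the left premise
   of its target; it carries no information unless that target is a tensor or
   par vertex. *)
Record graph (At : Type) : Type := Graph {
  edge : finType;
  vertex : finType;
  elabel : edge -> formula At;
  vlab : vertex -> vlabel;
  src : edge -> vertex;
  tgt : edge -> vertex;
  isleft : edge -> bool
}.
Arguments edge {At} g.
Arguments vertex {At} g.
Arguments elabel {At g} e.
Arguments vlab {At g} v.
Arguments src {At g} e.
Arguments tgt {At g} e.
Arguments isleft {At g} e.

Section Graphs.
Variables (At : Type) (g : graph At).
Implicit Types (v : vertex g) (e : edge g).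

Definition premises v : {set edge g} := [set e | tgt e == v].
Definition conclusions v : {set edge g} := [set e | src e == v].

Definition is_ax v e1 e2 : Prop :=
  [/\ vlab v = Vax, e1 != e2, premises v = set0, conclusions v = [set e1; e2]
    & elabel e2 = fneg (elabel e1)].

Definition is_cut v e1 e2 : Prop :=
  [/\ vlab v = Vcut, e1 != e2, premises v = [set e1; e2], conclusions v = set0
    & elabel e2 = fneg (elabel e1)].

Definition ordered_link v e1 e2 e3 : Prop :=
  [/\ e1 != e2, premises v = [set e1; e2], isleft e1, ~~ isleft e2
    & conclusions v = [set e3]].

Definition is_tens v e1 e2 e3 : Prop :=
  [/\ vlab v = Vtens, ordered_link v e1 e2 e3
    & elabel e3 = FTens (elabel e1) (elabel e2)].

Definition is_par v e1 e2 e3 : Prop :=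
  [/\ vlab v = Vpar, ordered_link v e1 e2 e3
    & elabel e3 = FPar (elabel e1) (elabel e2)].

Definition is_c v e : Prop :=
  [/\ vlab v = Vc, premises v = [set e] & conclusions v = set0].

Definition is_proof_structure : Prop :=
  forall v, match vlab v with
            | Vax => exists e1 e2, is_ax v e1 e2
            | Vcut => exists e1 e2, is_cut v e1 e2
            | Vtens => exists e1 e2 e3, is_tens v e1 e2 e3
            | Vpar => exists e1 e2 e3, is_par v e1 e2 e3
            | Vc => exists e, is_c v e
            end.

Definition single_conclusion (A : formula At) : Prop :=
  exists v e, [/\ [set w : vertex g | vlab w == Vc] = [set v], is_c v e
                & elabel e = A].

End Graphs.

Record proof_structure (At : Type) : Type := ProofStructure {
  ps_graph :> graph At;
  ps_wf : is_proof_structure ps_graph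
}.

Definition gsum (At : Type) (g h : graph At) : graph At :=
  {| edge := (edge g + edge h)%type;
     vertex := (vertex g + vertex h)%type;
     elabel e := match e with inl a => elabel a | inr b => elabel b end;
     vlab v := match v with inl a => vlab a | inr b => vlab b end;
     src e := match e with inl a => inl (src a) | inr b => inr (src b) end;
     tgt e := match e with inl a => inl (tgt a) | inr b => inr (tgt b) end;
     isleft e := match e with inl a => isleft a | inr b => isleft b end |}.

(* [em], [vm] embed [h] in [g], except that the vertices [c1] and [c2] of [h]
   are merged into the single vertex [l] of [g], whose label is arbitrary. *)
Record merges (At : Type) (h g : graph At) (c1 c2 : vertex h) (l : vertex g)
    (em : edge h -> edge g) (vm : vertex h -> vertex g) : Prop := Merges {
  mg_em_inj : injective em;
  mg_elabel : forall e, elabel (em e) = elabel e;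
  mg_src : forall e, src (em e) = vm (src e);
  mg_tgt : forall e, tgt (em e) = vm (tgt e);
  mg_isleft : forall e, ordered_label (vlab (tgt e)) -> isleft (em e) = isleft e;
  mg_vm_l : forall v, (vm v == l) = (v \in [set c1; c2]);
  mg_vm_inj : {in ~: [set c1; c2] &, injective vm};
  mg_vlab : forall v, v \notin [set c1; c2] -> vlab (vm v) = vlab v
}.

(* [g] is obtained from [h] by applying a cut (resp. tensor, par) link to the
   conclusions [e1], [e2] of [h]. *)
Definition adds_cut (At : Type) (h g : graph At) (e1 e2 : edge h) : Prop :=
  exists (c1 c2 : vertex h) (l : vertex g) em vm,
    [/\ is_c c1 e1 /\ is_c c2 e2, c1 != c2, merges c1 c2 l em vm,
        is_cut l (em e1) (em e2)
      & em @: setT = setT /\ vm @: setT = setT].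

Definition adds_tens (At : Type) (h g : graph At) (e1 e2 : edge h) : Prop :=
  exists (c1 c2 : vertex h) (l c : vertex g) (e : edge g) em vm,
    [/\ is_c c1 e1 /\ is_c c2 e2, c1 != c2, merges c1 c2 l em vm,
        is_tens l (em e1) (em e2) e /\ is_c c e
      & em @: setT = ~: [set e] /\ vm @: setT = ~: [set c]].

Definition adds_par (At : Type) (h g : graph At) (e1 e2 : edge h) : Prop :=
  exists (c1 c2 : vertex h) (l c : vertex g) (e : edge g) em vm,
    [/\ is_c c1 e1 /\ is_c c2 e2, c1 != c2, merges c1 c2 l em vm,
        is_par l (em e1) (em e2) e /\ is_c c e
      & em @: setT = ~: [set e] /\ vm @: setT = ~: [set c]].

Definition axiom_graph (At : Type) (g : graph At) : Prop :=
  exists x c1 c2 e1 e2,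
    [/\ is_ax x e1 e2, is_c c1 e1, is_c c2 e2,
        [set: edge g] = [set e1; e2] & [set: vertex g] = [set x; c1; c2]].

Inductive net (At : Type) : graph At -> Prop :=
  | net_ax g : axiom_graph g -> net g
  | net_tens h1 h2 g (e1 : edge h1) (e2 : edge h2) : net h1 -> net h2 ->
      @adds_tens At (gsum h1 h2) g (inl e1) (inr e2) -> net g
  | net_cut h1 h2 g (e1 : edge h1) (e2 : edge h2) : net h1 -> net h2 ->
      @adds_cut At (gsum h1 h2) g (inl e1) (inr e2) -> net g
  | net_par h g (e1 e2 : edge h) : net h -> adds_par g e1 e2 -> net g.

Definition is_proof_net (At : Type) (p : proof_structure At) : Prop := net p.

(* [U_pi]: an edge together with a position in the atom sequence of its label
   (positions start from 0). *)
Definition Uat (At : Type) (g : graph At) : finType :=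
  {e : edge g & 'I_(size (atoms (elabel e)))}.

Definition Upos (At : Type) (g : graph At) (U : Uat g) : nat := tagged U.

Definition Usign (At : Type) (g : graph At) (U : Uat g) : bool :=
  (tnth (in_tuple (atoms (elabel (tag U)))) (tagged U)).2.

Notation "'P_[' k ] g" := {mpoly k[#|Uat g|]}
  (at level 8, g at level 8, format "'P_[' k ]  g") : type_scope.

Definition Xvar (k : fieldType) (At : Type) (g : graph At) (U : Uat g) : P_[k] g :=
  'X_(enum_rank U).
Arguments Xvar k {At g} U.

(* [link_pair v U V]: [U - V] is one of the generators of the link [v]. In an
   ax or cut link the position [i] of [A] faces the position [n - 1 - i] of
   [neg A]; the two edges play the same role, so both orientations are listed.
   In a tensor or par link, [U] lies on a premise and [V] on the conclusion:
   left premises are aligned with the beginning of the conclusion and right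
   premises with its end. *)
Definition link_pair (At : Type) (g : graph At) (v : vertex g) (U V : Uat g) : bool :=
  let size_of (W : Uat g) := size (atoms (elabel (tag W))) in
  match vlab v with
  | Vax => [&& src (tag U) == v, src (tag V) == v, tag U != tag V
             & (Upos U + Upos V).+1 == size_of U]
  | Vcut => [&& tgt (tag U) == v, tgt (tag V) == v, tag U != tag V
              & (Upos U + Upos V).+1 == size_of U]
  | Vtens | Vpar =>
      [&& tgt (tag U) == v, src (tag V) == v
        & if isleft (tag U) then Upos V == Upos U
          else (Upos V + size_of U == Upos U + size_of V)%N]
  | Vc => false
  end.

Definition Gpi (k : fieldType) (At : Type) (g : graph At) : seq (P_[k] g) :=
  [seq Xvar k UV.1 - Xvar k UV.2
     | UV <- enum {: Uat g * Uat g} & [exists v, link_pair v UV.1 UV.2]].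
Arguments Gpi k {At} g.

Definition sim (k : fieldType) (At : Type) (g : graph At) : rel (Uat g) :=
  fun U V => (Xvar k U - Xvar k V \in Gpi k g) || (Xvar k V - Xvar k U \in Gpi k g).
Arguments sim k {At} g.

(* Reductions are taken up to renaming: [ar_em] and [ar_vm] identify the
   edges and vertices of [p'] with those of [p] that survive, the inserted edge
   being identified with [e3]. *)
Record a_reduction (At : Type) (p p' : proof_structure At) : Type := ARed {
  ar_cut : vertex p;
  ar_ax : vertex p;
  ar_e1 : edge p;
  ar_e2 : edge p;
  ar_e3 : edge p;
  ar_is_cut : is_cut ar_cut ar_e1 ar_e2;
  ar_is_ax : is_ax ar_ax ar_e2 ar_e3;
  ar_neq : ar_e3 != ar_e1;
  ar_em : edge p' -> edge p;
  ar_vm : vertex p' -> vertex p;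
  ar_em_inj : injective ar_em;
  ar_em_im : ar_em @: setT = ~: [set ar_e1; ar_e2];
  ar_vm_inj : injective ar_vm;
  ar_vm_im : ar_vm @: setT = ~: [set ar_cut; ar_ax];
  ar_elabel : forall e, elabel (ar_em e) = elabel e;
  ar_vlab : forall v, vlab (ar_vm v) = vlab v;
  ar_src : forall e,
    ar_vm (src e) = if ar_em e == ar_e3 then src ar_e1 else src (ar_em e);
  ar_tgt : forall e, ar_vm (tgt e) = tgt (ar_em e);
  ar_isleft : forall e,
    ordered_label (vlab (tgt e)) -> isleft (ar_em e) = isleft e
}.

(* [mr_k1] and [mr_k2] are the inserted cut links; [mr_vm] is only meaningful
   on the other vertices of [p']. *)
Record m_reduction (At : Type) (p p' : proof_structure At) : Type := MRed {
  mr_tens : vertex p;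
  mr_par : vertex p;
  mr_cut : vertex p;
  mr_eA : edge p;
  mr_eB : edge p;
  mr_eAB : edge p;
  mr_eNB : edge p;
  mr_eNA : edge p;
  mr_eNBNA : edge p;
  mr_is_tens : is_tens mr_tens mr_eA mr_eB mr_eAB;
  mr_is_par : is_par mr_par mr_eNB mr_eNA mr_eNBNA;
  mr_is_cut : is_cut mr_cut mr_eAB mr_eNBNA;
  mr_k1 : vertex p';
  mr_k2 : vertex p';
  mr_em : edge p' -> edge p;
  mr_vm : vertex p' -> vertex p;
  mr_k_neq : mr_k1 != mr_k2;
  mr_k1_cut : vlab mr_k1 = Vcut;
  mr_k2_cut : vlab mr_k2 = Vcut;
  mr_em_inj : injective mr_em;
  mr_em_im : mr_em @: setT = ~: [set mr_eAB; mr_eNBNA];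
  mr_vm_inj : {in ~: [set mr_k1; mr_k2] &, injective mr_vm};
  mr_vm_im : mr_vm @: (~: [set mr_k1; mr_k2]) = ~: [set mr_tens; mr_par; mr_cut];
  mr_elabel : forall e, elabel (mr_em e) = elabel e;
  mr_vlab : forall v, v \notin [set mr_k1; mr_k2] -> vlab (mr_vm v) = vlab v;
  mr_src : forall e,
    src e \notin [set mr_k1; mr_k2] /\ mr_vm (src e) = src (mr_em e);
  mr_tgt : forall e,
    if mr_em e \in [set mr_eA; mr_eNA] then tgt e = mr_k1
    else if mr_em e \in [set mr_eB; mr_eNB] then tgt e = mr_k2
    else tgt e \notin [set mr_k1; mr_k2] /\ mr_vm (tgt e) = tgt (mr_em e);
  mr_isleft : forall e,
    ordered_label (vlab (tgt e)) -> isleft (mr_em e) = isleft e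
}.

Inductive reduction (At : Type) (p p' : proof_structure At) : Type :=
  | Reda of a_reduction p p'
  | Redm of m_reduction p p'.

Inductive reduction_seq (At : Type) :
    proof_structure At -> proof_structure At -> Type :=
  | RedOne p p' : reduction p p' -> reduction_seq p p'
  | RedCons p q p' : reduction p q -> reduction_seq q p' -> reduction_seq p p'.

Definition red_em (At : Type) (p p' : proof_structure At) (c : reduction p p') :
    edge p' -> edge p :=
  match c with Reda a => ar_em a | Redm m => mr_em m end.

Lemma red_elabel (At : Type) (p p' : proof_structure At) (c : reduction p p')
  (e : edge p') : elabel (red_em c e) = elabel e.
Proof. by case: c => [a|m]; [apply: ar_elabel | apply: mr_elabel]. Qed.

Definition red_U (At : Type) (p p' : proof_structure At) (c : reduction p p')
    (U : Uat p') : Uat p :=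
  Tagged (fun e : edge p => 'I_(size (atoms (elabel e))))
    (cast_ord (congr1 (fun A => size (atoms A)) (esym (red_elabel c (tag U))))
       (tagged U)).

Definition Tred (k : fieldType) (At : Type) (p p' : proof_structure At)
    (c : reduction p p') (f : P_[k] p') : P_[k] p :=
  f \mPo [tuple Xvar k (red_U c (enum_val i)) | i < #|Uat p'|].

Fixpoint Tseq (k : fieldType) (At : Type) (p p' : proof_structure At)
    (Gam : reduction_seq p p') : P_[k] p' -> P_[k] p :=
  match Gam with
  | RedOne _ _ c => Tred c
  | RedCons _ _ _ c Gam' => fun f => Tred c (Tseq Gam' f)
  end.

Section Paths.
Variables (k : fieldType) (At : Type) (g : graph At).
Implicit Types (U V : Uat g) (s : seq (Uat g)).

Definition concl_atom U : bool := vlab (tgt (tag U)) == Vc.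

Definition persistent_path s : Prop :=
  if s is Z :: s' then
    [/\ uniq s, path (sim k g) Z s', s =i connect (sim k g) Z,
        concl_atom Z && ~~ Usign Z
      & concl_atom (last Z s') && Usign (last Z s')]
  else False.

Definition ends_before : rel (seq (Uat g)) := fun s t =>
  match s, t with
  | Z :: s', W :: t' => (Upos (last Z s') < Upos (last W t'))%N
  | _, _ => false
  end.

(* [Ps] is the list of all persistent paths, ordered by their last atoms. *)
Definition persistent_paths (Ps : seq (seq (Uat g))) : Prop :=
  [/\ forall s, s \in Ps -> persistent_path s,
      forall U, U \in flatten Ps
    & sorted ends_before Ps].

(* A total order on [U_pi] is given by the sequence of all its elements. *)
Definition seq_lt (s : seq (Uat g)) : rel (Uat g) :=
  fun U V => (index U s < index V s)%N.

(* The binomials [V - U] with [U ~ V] and [U < V], for the order given by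
   [s], listed by increasing [V] and then by increasing [U]. *)
Definition binomials s : seq (P_[k] g) :=
  [seq Xvar k V - Xvar k U
     | V <- s, U <- [seq U <- s | sim k g U V && seq_lt s U V]].

Definition lex_lt s : rel 'X_{1..#|Uat g|} :=
  fun m1 m2 => [exists V, (m1 (enum_rank V) < m2 (enum_rank V))%N &&
    [forall W, seq_lt s V W ==> (m1 (enum_rank W) == m2 (enum_rank W))]].

End Paths.

Definition order0 (At : Type) (g : graph At) (Ps : seq (seq (Uat g))) : seq (Uat g) :=
  flatten Ps.

Section OrderGamma.
Variables (k : fieldType) (At : Type) (p p' : proof_structure At).
Variable Gam : reduction_seq p p'.

Definition in_image (U : Uat p) : bool :=
  [exists U' : Uat p', Tseq Gam (Xvar k U') == Xvar k U].

Definition order_Gamma (Ps : seq (seq (Uat p))) : seq (Uat p) :=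
  flatten [seq [seq U <- s | in_image U] | s <- Ps] ++
  flatten [seq [seq U <- s | ~~ in_image U] | s <- Ps].

End OrderGamma.

Section Buchberger.
Variables (k : fieldType) (n : nat) (lt : rel 'X_{1..n}).
Notation poly := {mpoly k[n]}.
Implicit Types (f h p r : poly) (F G H : seq poly) (B : seq (nat * nat)).

(* The default [0%MM], i.e. the monomial 1, is least for a monomial order. *)
Definition LM f : 'X_{1..n} :=
  foldr (fun m m' => if lt m' m then m else m') 0%MM (msupp f).
Definition LC f : k := f@_(LM f).

Definition LTdvd f h : bool := (f != 0) && (LM f <= LM h)%MM.

Definition LTquo h f : poly := (LC h / LC f) *: 'X_[LM h - LM f].

Definition Lcm f h : 'X_{1..n} := mlcm (LM f) (LM h).

Definition Spoly f h : poly :=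
  (LC f)^-1 *: 'X_[Lcm f h - LM f] * f - (LC h)^-1 *: 'X_[Lcm f h - LM h] * h.

(* [div_es F p r]: the division of [p] by [F] stops with remainder [r]; [F`_i]
   is the first divisor that applies, and the quotients are not recorded. *)
Inductive div_es F : poly -> poly -> Prop :=
  | div_zero : div_es F 0 0
  | div_reduce p r (i := find (fun f => LTdvd f p) F) :
      p != 0 -> has (fun f => LTdvd f p) F ->
      div_es F (p - LTquo p F`_i * F`_i) r -> div_es F p r
  | div_stop p : p != 0 -> ~~ has (fun f => LTdvd f p) F -> div_es F p p.

Definition pair_sort (i j : nat) : nat * nat := (minn i j, maxn i j).

Definition criterion G B (i j : nat) : bool :=
  [exists l : 'I_(size G),
    [&& (l : nat) != i, (l : nat) != j, pair_sort i l \notin B,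
        pair_sort j l \notin B & (LM G`_l <= Lcm G`_i G`_j)%MM]].

Definition treated G B (i j : nat) : bool :=
  (Lcm G`_i G`_j != LM G`_i + LM G`_j)%MM && ~~ criterion G B i j.

Definition lex_first B (i j : nat) : Prop :=
  (i, j) \in B /\
  forall i' j', (i', j') \in B -> (i < i')%N || ((i == i') && (j <= j')%N).

(* What the pair (i, j) contributes: the remainder [r] of the S-polynomial, or
   0 (nothing is added) if the pair is discarded. *)
Definition pair_remainder G B (i j : nat) r : Prop :=
  if treated G B i j then div_es G (Spoly G`_i G`_j) r else r = 0.

(* [buch_loop G B H]: from the current list [G] and set [B] of pairs (indices
   start from 0), the loop terminates with output [H]. *)
Inductive buch_loop : seq poly -> seq (nat * nat) -> seq poly -> Prop :=
  | buch_done G : buch_loop G [::] G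
  | buch_next G B i j r H :
      lex_first B i j -> pair_remainder G B i j r ->
      (let G' := if r == 0 then G else rcons G ((LC r)^-1 *: r) in
       let B' := if r == 0 then B
                 else B ++ [seq (i', size G) | i' <- iota 0 (size G)] in
       buch_loop G' [seq q <- B' | q != (i, j)] H) ->
      buch_loop G B H.

(* [buchberger_es F H]: the algorithm terminates on [F], with output [H]. *)
Definition buchberger_es F H : Prop :=
  buch_loop F [seq (i, j) | j <- iota 0 (size F), i <- iota 0 j] H.

Lemma div_es_fun F p r r' : div_es F p r -> div_es F p r' -> r = r'.
Proof.
move=> D; elim: D r' => {p r} [r' D'|p r i p0 hF D IH r' D'|p p0 hF r' D'];
  inversion D'; subst=> //; try exact: IH;
  by match goal with
     | h : is_true (_ != _) |- _ => rewrite eqxx in h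
     | h : is_true (has _ _), h' : is_true (~~ has _ _) |- _ => rewrite h in h'
     end.
Qed.

Lemma lex_first_fun B i j i' j' :
  lex_first B i j -> lex_first B i' j' -> i = i' /\ j = j'.
Proof.
move=> [ijB min] [ijB' min'].
have := min' _ _ ijB; have := min _ _ ijB'.
case: (ltngtP i i') => //= <- le1 le2.
by split=> //; apply/eqP; rewrite eqn_leq le1 le2.
Qed.

Lemma buchberger_es_fun F H H' : buchberger_es F H -> buchberger_es F H' -> H = H'.
Proof.
rewrite /buchberger_es; move: [seq _ | j <- _, i <- _] => B L.
elim: L H' => {F B H} [G H' L'|G B i j r H f d L IH H' L'].
  by inversion L' as [|? ? ? ? ? ? [] ].
inversion L' as [? eG eB|? ? i' j' r' ? f' d' L'' eG eB]; subst; first by case: f.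
have [? ?] := lex_first_fun f f'; subst i' j'.
suff e : r = r' by subst r'; apply: IH.
move: d d'; rewrite /pair_remainder; case: ifP => _; first exact: div_es_fun.
by move=> -> ->.
Qed.

End Buchberger.

(* Main.v *)
Require Import Defs.
From mathcomp Require Import all_boot all_algebra.
From mathcomp.multinomials Require Import mpoly.
From mathcomp Require Import zify.

Set Implicit Arguments.
Unset Strict Implicit.
Unset Printing Implicit Defensive.

Import GRing.Theory.
Local Open Scope ring_scope.

(** The atoms of a proof net are arranged in persistent paths: an atom has at
    most one neighbour at the source and at most one at the target of its edge,
    and only the atoms of the conclusion have a free end. Both sides of the
    equality are read off from these paths.

    The reduct. A redex only shortens paths. Two neighbours of the reduct are
    joined in the original structure by a chain of neighbours whose inner atoms
    all lie on deleted edges ([seq_walk]), and a path can only be followed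
    through such a chain in one of its two directions ([walk_next_in]). Since
    atoms of the conclusion survive with their signs, the negative end of a path
    of the reduct is sent to a negative end, which fixes the direction along the
    whole path. So the paths of the reduct are the paths of the original
    structure with the deleted atoms erased ([nxt_image], [image_nxt]), and the
    left-hand side consists of the binomials [X' - X] for consecutive surviving
    atoms [X], [X'] of a path, in this order ([next_in]).

    The algorithm. In the elimination order every surviving atom is smaller than
    every deleted one, and otherwise the order follows the paths. The leading
    term of a binomial is thus a single variable, and only pairs with the same
    leading variable are treated. For the initial binomials such a coincidence
    happens once for each stretch [X, Y1, ..., Yn, X'] of a path with deleted
    atoms [Yi] between surviving [X] and [X']: the last atom [Yn] leads both
    [Yn - X'] and the binomial with its predecessor. The S-polynomial is, up to
    sign, that predecessor minus [X'], and the division descends the stretch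
    until it reaches [X - X'] ([div_run]). Now the leading variable is the
    surviving [X'], which leads no initial binomial since its predecessor is
    deleted: early stopping leaves [X - X'], which is normalised to [X' - X].
    These new binomials have leading variables of their own and create no
    further pairs. Hence the output consists of the initial binomials and all
    [X' - X] for consecutive survivors ([buchberger_elim_order]). Those with a
    deleted leading variable are not in the image of the reduct
    ([bin_Tseq_in]), and what remains is the left-hand side. *)

(** * Neighbours of an atom *)

Section Neighbours.
Variables (At : Type) (g : graph At).
Implicit Types (U V W : Uat g) (v : vertex g).

Lemma mcoeff_XvarB (k : fieldType) U V W :
  (Xvar k U - Xvar k V)@_U_(enum_rank W) = (U == W)%:R - (V == W)%:R.
Proof.
rewrite mcoeffB !mcoeffX.
have e (X Y : Uat g) : (U_(enum_rank X)%MM == U_(enum_rank Y)%MM) = (X == Y).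
  apply/eqP/eqP => [/mnmP /(_ (enum_rank Y))|->] //.
  by rewrite !mnm1E eqxx; case: eqP => // /enum_rank_inj.
by rewrite !e.
Qed.

(** Only the unordered pair can be recovered: over a field of characteristic 2
    the binomials [U - V] and [V - U] coincide. *)
Lemma XvarB_inj (k : fieldType) U V U' V' : U != V ->
  Xvar k U - Xvar k V = Xvar k U' - Xvar k V' ->
  (U' = U /\ V' = V) \/ (U' = V /\ V' = U).
Proof.
move=> UV e.
have mem W : (U == W) != (V == W) -> (U' == W) || (V' == W).
  move=> UVW; apply: contraT; rewrite negb_or => /andP[/negbTE U'W /negbTE V'W].
  have := mcoeff_XvarB k U V W; rewrite e mcoeff_XvarB U'W V'W subrr.
  move: UVW; case: (U == W); case: (V == W) => //= _ /eqP.
    by rewrite subr0 eq_sym oner_eq0.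
  by rewrite sub0r eq_sym oppr_eq0 oner_eq0.
have /mem/orP mU : (U == U) != (V == U) by rewrite eqxx [V == U]eq_sym (negbTE UV).
have /mem/orP mV : (U == V) != (V == V) by rewrite eqxx (negbTE UV).
by case: mU mV => /eqP eU [] /eqP eV; subst;
  first [by rewrite eqxx in UV | by left | by right].
Qed.

Definition linked v U V : bool := link_pair v U V || link_pair v V U.

Lemma size_atoms_fneg (B : formula At) : size (atoms (fneg B)) = size (atoms B).
Proof. by rewrite atoms_neg size_rev size_map. Qed.

Lemma size_atoms_gt0 (B : formula At) : (0 < size (atoms B))%N.
Proof. by elim: B => //= B hB C hC; rewrite size_cat addn_gt0 hB. Qed.

Lemma Uat_inj U V : tag U = tag V -> Upos U = Upos V -> U = V.
Proof.
case: U V => [e i] [e' j] /= ee'; case: _ / ee' j => j ij.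
by congr existT; apply: val_inj.
Qed.

Lemma Upos_lt U : (Upos U < size (atoms (elabel (tag U))))%N.
Proof. exact: ltn_ord. Qed.

Definition mkU (e : edge g) (i : nat) (lt : (i < size (atoms (elabel e)))%N) :
    Uat g := Tagged (fun e => 'I_(size (atoms (elabel e)))) (Ordinal lt).

Lemma Upos_mkU (e : edge g) i (lt : (i < size (atoms (elabel e)))%N) :
  Upos (mkU lt) = i.
Proof. by []. Qed.

Lemma in_premises v e : (e \in premises v) = (tgt e == v).
Proof. by rewrite inE. Qed.

Lemma in_conclusions v e : (e \in conclusions v) = (src e == v).
Proof. by rewrite inE. Qed.

Hypothesis wf : is_proof_structure g.

(** A self-loop would have to be both a premise and the conclusion of a tensor
    or par link, and the label of the conclusion is strictly longer. *)
Lemma src_neq_tgt e : src e != tgt e :> vertex g.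
Proof.
apply/eqP => se; have := wf (src e).
have hc : e \in conclusions (src e) by rewrite in_conclusions.
have hp : e \in premises (src e) by rewrite in_premises se.
case E: (vlab (src e)).
- by case=> [e1 [e2 [_ _ h]]]; rewrite h inE in hp.
- by case=> [e1 [e2 [_ _ _ h]]]; rewrite h inE in hc.
- case=> [e1 [e2 [e3 [_ [_ h1 _ _ h2] lab]]]]; move: hp hc.
  rewrite h1 h2 !inE => h /eqP he; subst e3.
  have := congr1 (fun A => size (atoms A)) lab; rewrite /= size_cat.
  have := size_atoms_gt0 (elabel e1); have := size_atoms_gt0 (elabel e2).
  case/orP: h => /eqP <-; lia.
- case=> [e1 [e2 [e3 [_ [_ h1 _ _ h2] lab]]]]; move: hp hc.
  rewrite h1 h2 !inE => h /eqP he; subst e3.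
  have := congr1 (fun A => size (atoms A)) lab; rewrite /= size_cat.
  have := size_atoms_gt0 (elabel e1); have := size_atoms_gt0 (elabel e2).
  case/orP: h => /eqP <-; lia.
- by case=> [e1 [_ _ h]]; rewrite h inE in hc.
Qed.

Lemma link_pair_neq v U V : link_pair v U V -> U != V.
Proof.
rewrite /link_pair; case E: (vlab v) => //.
- by case/and4P=> _ _ + _; apply: contraNneq => ->.
- by case/and4P=> _ _ + _; apply: contraNneq => ->.
- case/and3P=> /eqP e1 /eqP e2 _; apply/eqP => UV; subst V.
  by have := src_neq_tgt (tag U); rewrite e1 e2 eqxx.
- case/and3P=> /eqP e1 /eqP e2 _; apply/eqP => UV; subst V.
  by have := src_neq_tgt (tag U); rewrite e1 e2 eqxx.
Qed.

Lemma simP (k : fieldType) U V : reflect (exists v, linked v U V) (sim k g U V).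
Proof.
have memG X Y : reflect (exists v, link_pair v X Y \/ link_pair v Y X)
                  (sim k g X Y).
  apply: (iffP orP) => [[]|[v [] h]].
  - case/mapP=> [[X' Y']]; rewrite mem_filter => /andP[/existsP[v /= h] _] /= e.
    exists v; have [[-> ->]|[-> ->]] := XvarB_inj (link_pair_neq h) (esym e);
      by [left|right].
  - case/mapP=> [[X' Y']]; rewrite mem_filter => /andP[/existsP[v /= h] _] /= e.
    exists v; have [[-> ->]|[-> ->]] := XvarB_inj (link_pair_neq h) (esym e);
      by [left|right].
  - left; apply/mapP; exists (X, Y) => //.
    by rewrite mem_filter mem_enum inE andbT; apply/existsP; exists v.
  - right; apply/mapP; exists (Y, X) => //.
    by rewrite mem_filter mem_enum inE andbT; apply/existsP; exists v.
by apply: (iffP (memG U V)) => -[v h]; exists v; apply/orP.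
Qed.

Lemma simC (k : fieldType) : ssrbool.symmetric (sim k g).
Proof. by move=> U V; rewrite /sim orbC. Qed.

Lemma linked_end v U V : linked v U V -> v = src (tag U) \/ v = tgt (tag U).
Proof.
rewrite /linked /link_pair; case: (vlab v) => //.
- by case/orP=> /and4P[/eqP a /eqP b _ _]; left.
- by case/orP=> /and4P[/eqP a /eqP b _ _]; right.
- by case/orP=> /and3P[/eqP a /eqP b _]; [right|left].
- by case/orP=> /and3P[/eqP a /eqP b _]; [right|left].
Qed.

Lemma ordered_linked_fun v U V W e1 e2 e3 :
  ordered_label (vlab v) -> ordered_link v e1 e2 e3 ->
  size (atoms (elabel e3)) =
    (size (atoms (elabel e1)) + size (atoms (elabel e2)))%N ->
  linked v U V -> linked v U W -> V = W.
Proof.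
move=> lab [e12 hp l1 l2 hc] sz.
have prem e : tgt e = v -> e = e1 \/ e = e2.
  by move/eqP; rewrite -in_premises hp !inE => /orP[]/eqP; [left|right].
have conc e : src e = v -> e = e3.
  by move/eqP; rewrite -in_conclusions hc inE => /eqP.
have lkE X Y : link_pair v X Y =
    [&& tgt (tag X) == v, src (tag Y) == v
      & if isleft (tag X) then Upos Y == Upos X
        else (Upos Y + size (atoms (elabel (tag X))) ==
              Upos X + size (atoms (elabel (tag Y))))%N].
  by move: lab; rewrite /link_pair /ordered_label; case: (vlab v).
have no (X : Uat g) : tgt (tag X) = v -> src (tag X) = v -> False.
  by move=> <- /eqP; apply/negP/src_neq_tgt.
rewrite /linked !lkE => /orP[] /and3P[/eqP a /eqP b c] /orP[] /and3P[/eqP a' /eqP b' c'].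
- apply: Uat_inj; first by rewrite (conc _ b) (conc _ b').
  move: c c'; rewrite (conc _ b) (conc _ b').
  by case: ifP => _ /eqP h /eqP h'; lia.
- by case: (no U).
- by case: (no U).
have tV := prem _ a; have tW := prem _ a'.
have := Upos_lt V; have := Upos_lt W; move: c c'; rewrite (conc _ b) sz.
case: tV => tV; case: tW => tW; rewrite tV tW ?l1 ?(negbTE l2) => /eqP c /eqP c' ? ?.
- by apply: Uat_inj; rewrite ?tV ?tW //; lia.
- lia.
- lia.
- by apply: Uat_inj; rewrite ?tV ?tW //; lia.
Qed.

(** The edge facing that of [U] and the position on it are determined by [U]; on
    the conclusion of a tensor or par link the position tells which of the two
    premises is faced. *)
Lemma linked_fun v U V W : linked v U V -> linked v U W -> V = W.
Proof.
have := wf v; case lab: (vlab v).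
- case=> e1 [e2 [_ e12 _ hc sz]]; rewrite /linked /link_pair lab.
  have conc (X : Uat g) : src (tag X) = v -> tag X = e1 \/ tag X = e2.
    by move/eqP; rewrite -in_conclusions hc !inE => /orP[]/eqP; [left|right].
  have {}sz (X : Uat g) : src (tag X) = v ->
      size (atoms (elabel (tag X))) = size (atoms (elabel e1)).
    by case/conc=> ->; rewrite ?sz ?size_atoms_fneg.
  have sym (X Y : Uat g) : [&& src (tag X) == v, src (tag Y) == v, tag X != tag Y &
      (Upos X + Upos Y).+1 == size (atoms (elabel (tag X)))] =
      [&& src (tag Y) == v, src (tag X) == v, tag Y != tag X &
      (Upos Y + Upos X).+1 == size (atoms (elabel (tag Y)))].
    rewrite andbCA addnC (eq_sym (tag X)).
    by have [/sz ->|] := altP eqP; have [/sz ->|] := altP eqP.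
  rewrite -!(sym U) !orbb => /and4P[/eqP a /eqP b c d] /and4P[_ /eqP b' c' d'].
  move: (d) (d') => /eqP d1 /eqP d2.
  apply: Uat_inj; last by lia.
  by move: c c'; case: (conc _ a) => ->; case: (conc _ b) => ->;
    case: (conc _ b') => ->; rewrite ?eqxx.
- case=> e1 [e2 [_ e12 hc _ sz]]; rewrite /linked /link_pair lab.
  have conc (X : Uat g) : tgt (tag X) = v -> tag X = e1 \/ tag X = e2.
    by move/eqP; rewrite -in_premises hc !inE => /orP[]/eqP; [left|right].
  have {}sz (X : Uat g) : tgt (tag X) = v ->
      size (atoms (elabel (tag X))) = size (atoms (elabel e1)).
    by case/conc=> ->; rewrite ?sz ?size_atoms_fneg.
  have sym (X Y : Uat g) : [&& tgt (tag X) == v, tgt (tag Y) == v, tag X != tag Y &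
      (Upos X + Upos Y).+1 == size (atoms (elabel (tag X)))] =
      [&& tgt (tag Y) == v, tgt (tag X) == v, tag Y != tag X &
      (Upos Y + Upos X).+1 == size (atoms (elabel (tag Y)))].
    rewrite andbCA addnC (eq_sym (tag X)).
    by have [/sz ->|] := altP eqP; have [/sz ->|] := altP eqP.
  rewrite -!(sym U) !orbb => /and4P[/eqP a /eqP b c d] /and4P[_ /eqP b' c' d'].
  move: (d) (d') => /eqP d1 /eqP d2.
  apply: Uat_inj; last by lia.
  by move: c c'; case: (conc _ a) => ->; case: (conc _ b) => ->;
    case: (conc _ b') => ->; rewrite ?eqxx.
- case=> e1 [e2 [e3 [_ ol lb]]]; apply: ordered_linked_fun ol _.
    by rewrite /ordered_label lab.
  by rewrite lb /= size_cat.
- case=> e1 [e2 [e3 [_ ol lb]]]; apply: ordered_linked_fun ol _.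
    by rewrite /ordered_label lab.
  by rewrite lb /= size_cat.
- by rewrite /linked /link_pair lab.
Qed.

(** An atom has at most one neighbour at each end of its edge, by
    [linked_fun]. *)
Lemma sim_degree2 (k : fieldType) U V W X :
  sim k g U V -> sim k g U W -> sim k g U X -> V != W -> X = V \/ X = W.
Proof.
case/simP=> v hv /simP[w hw] /simP[x hx] VW.
have vw : v <> w.
  by move=> vw; subst w; rewrite (linked_fun hv hw) eqxx in VW.
have [xv|xw] : x = v \/ x = w.
  have := linked_end hv; have := linked_end hw; have := linked_end hx.
  by case=> ex [] ew [] ev;
    first [left; congruence | right; congruence | case: vw; congruence].
- by left; subst x; apply: linked_fun hx hv.
- by right; subst x; apply: linked_fun hx hw.
Qed.

Lemma sim_concl_fun (k : fieldType) U V W :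
  concl_atom U -> sim k g U V -> sim k g U W -> V = W.
Proof.
move=> /eqP cU /simP[v hv] /simP[w hw].
have src_of x X : linked x U X -> x = src (tag U).
  move=> h; case: (linked_end h) => // e; move: h.
  by rewrite e /linked /link_pair cU.
move: (src_of _ _ hv) (src_of _ _ hw) => ev ew; subst v w.
exact: linked_fun hv hw.
Qed.

End Neighbours.

(** * Persistent paths as the order of their concatenation *)

Lemma index_last (T : eqType) (x y : T) s : (index y (x :: s)).+1 = size (x :: s) ->
  y \in x :: s -> last x s = y.
Proof. by case=> e ys; rewrite (last_nth x) -e nth_index. Qed.

Section OnePath.
Variables (k : fieldType) (At : Type) (g : graph At).
Hypothesis wf : is_proof_structure g.
Variable s : seq (Uat g).
Hypothesis ps : persistent_path k s.
Implicit Types U V : Uat g.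

Lemma persistent_uniq : uniq s.
Proof. by move: ps; case: s => // Z s' []. Qed.

(** A path has two distinct ends, because they have opposite signs. *)
Lemma persistent_size : (1 < size s)%N.
Proof.
by move: ps; case: s => // Z [|W s'] //= [_ _ _ /andP[_ /negbTE ->]]; rewrite andbF.
Qed.

Lemma persistent_sim U0 i : (i.+1 < size s)%N ->
  sim k g (nth U0 s i) (nth U0 s i.+1).
Proof. by move: ps; case: s => // Z s' [_ /(pathP U0) h _ _ _] /h. Qed.

Lemma persistent_closed U V : U \in s -> sim k g U V -> V \in s.
Proof.
move: ps; case: s => // Z s' [_ _ e _ _]; rewrite !e => cU UV.
exact: connect_trans cU (connect1 UV).
Qed.

Lemma persistent_head U0 : concl_atom (nth U0 s 0) && ~~ Usign (nth U0 s 0).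
Proof. by move: ps; case: s => // Z s' []. Qed.

Lemma persistent_last U0 :
  concl_atom (nth U0 s (size s).-1) && Usign (nth U0 s (size s).-1).
Proof. by move: ps; case: s => // Z s' [_ _ _ _]; rewrite nth_last. Qed.

(** Inner atoms of a path have two neighbours, whereas an atom of the conclusion
    has none at the target of its edge. *)
Lemma concl_atom_end U : U \in s -> concl_atom U ->
  index U s = 0%N \/ (index U s).+1 = size s.
Proof.
move=> Us cU; have hi : (index U s < size s)%N by rewrite index_mem.
case Ei: (index U s) hi => [|i] hi; [by left | right].
apply/eqP; rewrite eqn_leq hi leqNgt; apply/negP => hi'.
have eU : nth U s i.+1 = U by rewrite -Ei nth_index.
have s1 := persistent_sim U (ltnW hi'); have s2 := persistent_sim U hi'.
rewrite eU in s1 s2; rewrite simC in s1.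
have /eqP := sim_concl_fun wf cU s1 s2.
by rewrite nth_uniq ?persistent_uniq //; [move=> /eqP; lia | exact: ltnW].
Qed.

Lemma concl_atom_sign U : U \in s -> concl_atom U ->
  if Usign U then (index U s).+1 = size s else index U s = 0%N.
Proof.
move=> Us cU; have := persistent_size.
case: (concl_atom_end Us cU) => h; have := nth_index U Us.
  by rewrite h => e; have := persistent_head U; rewrite e cU /= => /negbTE ->.
have := persistent_last U; rewrite -h /= => /andP[_ S] e.
by move: S; rewrite e => ->.
Qed.

Lemma sim_index U V : U \in s -> sim k g U V ->
  index V s = (index U s).+1 \/ index U s = (index V s).+1.
Proof.
move=> Us UV; have Vs := persistent_closed Us UV.
have hi : (index U s < size s)%N by rewrite index_mem.
have idx i : (i < size s)%N -> nth U s i = V -> index V s = i.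
  by move=> lti <-; rewrite index_uniq ?persistent_uniq.
have eU := nth_index U Us.
have next : ((index U s).+1 < size s)%N -> sim k g U (nth U s (index U s).+1).
  by move/(persistent_sim U); rewrite eU.
have prev i : index U s = i.+1 -> sim k g U (nth U s i).
  by move=> e; have := @persistent_sim U i; rewrite -e eU simC; apply.
case Ei: (index U s) hi prev next => [|i] hi prev next.
  left; apply: idx; first exact: persistent_size.
  have cU : concl_atom U.
    by have /andP[+ _] := persistent_head U; rewrite -[X in nth _ _ X]Ei eU.
  by rewrite (sim_concl_fun wf cU UV (next persistent_size)).
have {}prev := prev i erefl.
have [hl|hl] := ltnP i.+2 (size s); last first.
  right; congr S; apply/esym/idx; first exact: ltnW.
  have cU : concl_atom U.
    have /andP[+ _] := persistent_last U.
    have -> : (size s).-1 = index U s by lia.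
    by rewrite eU.
  exact: sim_concl_fun prev UV.
case: (sim_degree2 wf prev (next hl) UV).
- by rewrite nth_uniq ?persistent_uniq // ?ltn_eqF //; exact: ltnW.
- by move=> e; right; congr S; apply/esym/idx => //; exact: ltnW.
- by move=> e; left; apply: idx.
Qed.

End OnePath.

(** The order in which the atoms of all persistent paths are listed; [nxt] is
    the successor relation of the paths. *)
Definition pos (At : Type) (g : graph At) (Ps : seq (seq (Uat g))) (U : Uat g) : nat :=
  index U (flatten Ps).

Definition nxt (k : fieldType) (At : Type) (g : graph At)
    (Ps : seq (seq (Uat g))) (U V : Uat g) : bool :=
  sim k g U V && (pos Ps V == (pos Ps U).+1).

Section AllPaths.
Variables (k : fieldType) (At : Type) (g : graph At).
Hypothesis wf : is_proof_structure g.
Variable Ps : seq (seq (Uat g)).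
Hypothesis hPs : persistent_paths k Ps.
Implicit Types U V : Uat g.

Lemma mem_flatten_paths U : U \in flatten Ps.
Proof. by case: hPs. Qed.

(** Two paths with a common atom exhaust the same class, so that they have the
    same positive end and cannot be ordered by it. *)
Lemma uniq_flatten_paths : uniq (flatten Ps).
Proof.
case: hPs => hP _; elim: Ps hP => //= s Qs IH hP sQ.
have hs : persistent_path k s by apply: hP; rewrite mem_head.
have hQ t : t \in Qs -> persistent_path k t by move=> h; apply: hP; rewrite inE h orbT.
have /allP mins : all (ends_before (g := g) s) Qs.
  apply: order_path_min sQ => -[|a x] [|b y] [|c z] //=; exact: ltn_trans.
rewrite cat_uniq (persistent_uniq hs) IH ?(path_sorted sQ) // andbT /=.
apply/hasPn => U /flattenP[t tQ Ut]; apply/negP => Us.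
have {}hQ := hQ t tQ; have := mins t tQ.
case: s t hs hQ Us Ut {hP sQ mins tQ} => // Z s [] // W t hs ht Us Ut.
rewrite /ends_before.
have [_ _ es _ /andP[cs ss]] := hs; have [_ _ et _ _] := ht.
have cUt : connect (sim k g) W (last Z s).
  have ZU : connect (sim k g) Z U by move: Us; rewrite es.
  have WU : connect (sim k g) W U by move: Ut; rewrite et.
  have UZ : connect (sim k g) U Z by rewrite (sym_connect_sym (simC k (g := g))).
  apply: connect_trans WU (connect_trans UZ _).
  by have := mem_last Z s; rewrite es.
have := @concl_atom_sign k _ _ wf (W :: t) ht (last Z s).
rewrite et => /(_ cUt cs); rewrite ss => /index_last -> //; first by rewrite ltnn.
by rewrite et.
Qed.

Lemma pos_inj U V : pos Ps U = pos Ps V -> U = V.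
Proof.
rewrite /pos => e; rewrite -(nth_index U (mem_flatten_paths U)) e.
exact/nth_index/mem_flatten_paths.
Qed.

Lemma pos_path U : exists s c, [/\ s \in Ps, U \in s
  & forall V, V \in s -> pos Ps V = (c + index V s)%N].
Proof.
have /flattenP[s sP Us] := mem_flatten_paths U.
have uP := uniq_flatten_paths; exists s; rewrite /pos.
have [P1 [P2 e]] : exists P1 P2, Ps = P1 ++ s :: P2.
  by case/splitPr: sP => P1 P2; exists P1, P2.
exists (size (flatten P1)); split=> // V Vs; move: uP.
rewrite e flatten_cat /= cat_uniq has_cat => /and3P[_ /norP[/hasPn n _] _].
by rewrite index_cat (negbTE (n V Vs)) index_cat Vs.
Qed.

Lemma sim_pos U V : sim k g U V -> nxt k Ps U V \/ nxt k Ps V U.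
Proof.
move=> UV; have [s [c [sP Us e]]] := pos_path U.
have ps : persistent_path k s by case: hPs => h _ _; apply: h.
rewrite /nxt [sim k g V U]simC UV /= (e U Us) (e V (persistent_closed ps Us UV)).
by case: (sim_index wf ps Us UV) => ->; [left|right]; rewrite addnS.
Qed.

Lemma nxt_fun U V W : nxt k Ps U V -> nxt k Ps U W -> V = W.
Proof. by move=> /andP[_ /eqP e] /andP[_ /eqP e']; apply: pos_inj; rewrite e e'. Qed.

Lemma nxt_inj U V W : nxt k Ps V U -> nxt k Ps W U -> V = W.
Proof. by move=> /andP[_ /eqP e] /andP[_ /eqP]; rewrite e => -[/pos_inj]. Qed.

Lemma concl_or_prev V : concl_atom V && ~~ Usign V \/ exists U, nxt k Ps U V.
Proof.
have [s [c [sP Vs e]]] := pos_path V.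
have ps : persistent_path k s by case: hPs => h _ _; apply: h.
have := nth_index V Vs; have := Vs; rewrite -index_mem.
case Ei: (index V s) => [|i] hi eV.
  by left; rewrite -eV; apply: (persistent_head ps).
right; have ls : (i < size s)%N by exact: ltnW.
exists (nth V s i); rewrite /nxt -[X in sim k g _ X]eV (persistent_sim ps) //=.
by rewrite (e _ Vs) (e _ (mem_nth _ ls)) index_uniq ?(persistent_uniq ps) // Ei addnS.
Qed.

Lemma concl_or_next U : concl_atom U && Usign U \/ exists V, nxt k Ps U V.
Proof.
have [s [c [sP Us e]]] := pos_path U.
have ps : persistent_path k s by case: hPs => h _ _; apply: h.
have := nth_index U Us; have := Us; rewrite -index_mem => hi eU.
have [hl|hl] := ltnP (index U s).+1 (size s).
  right; exists (nth U s (index U s).+1).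
  rewrite /nxt -[X in sim k g X _]eU (persistent_sim ps) //=.
  by rewrite (e _ Us) (e _ (mem_nth _ hl)) index_uniq ?(persistent_uniq ps) // addnS.
left; have := persistent_last ps U.
have /eqP -> : size s == (index U s).+1 by rewrite eqn_leq hl hi.
by rewrite /= eU.
Qed.

Lemma nxt_concl U V : nxt k Ps U V ->
  ~~ (concl_atom U && Usign U) /\ ~~ (concl_atom V && ~~ Usign V).
Proof.
case/andP=> UV /eqP; have [s [c [sP Us e]]] := pos_path U.
have ps : persistent_path k s by case: hPs => h _ _; apply: h.
have Vs := persistent_closed ps Us UV; rewrite (e U Us) (e V Vs) -addnS => /addnI eI.
have hV : (index V s < size s)%N by rewrite index_mem.
split; apply/negP => /andP[].
  by move=> /(concl_atom_sign wf ps Us) + S; rewrite S -eI => e1; rewrite e1 ltnn in hV.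
by move=> /(concl_atom_sign wf ps Vs) + /negbTE S; rewrite S eI.
Qed.

End AllPaths.

(** * Walks avoiding the surviving atoms *)

(** The trace, before a reduction, of two atoms that the reduction makes
    neighbours: [Q] is the set of surviving atoms, so that the atoms strictly
    inside the chain are deleted ones. *)
Inductive walk (k : fieldType) (At : Type) (g : graph At) (Q : pred (Uat g))
    (U : Uat g) : Uat g -> Prop :=
  | walk1 V : sim k g U V -> walk k Q U V
  | walkS V W : walk k Q U V -> ~~ Q V -> sim k g V W -> walk k Q U W.

Section Walks.
Variables (k : fieldType) (At : Type) (g : graph At) (Q : pred (Uat g)).
Implicit Types U V W : Uat g.

Lemma walk_trans U V W : walk k Q U V -> ~~ Q V -> walk k Q V W -> walk k Q U W.
Proof.
move=> UV QV; elim=> {W} [W VW|V' W _ UV' QV' VW]; first exact: walkS UV QV VW.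
exact: walkS UV' QV' VW.
Qed.

Lemma walkC U V : walk k Q U V -> walk k Q V U.
Proof.
elim=> {V} [V UV|V W _ VU QV VW]; first by apply: walk1; rewrite simC.
by apply: walk_trans QV VU; apply: walk1; rewrite simC.
Qed.

End Walks.

(** * Reductions *)

Section OneReduction.
Variables (k : fieldType) (At : Type) (p p' : proof_structure At).

Lemma Tred_Xvar (c : reduction p p') U : Tred c (Xvar k U) = Xvar k (red_U c U).
Proof.
by rewrite /Tred /Xvar comp_mpolyXU -tnth_nth tnth_mktuple enum_rankK.
Qed.

Lemma red_U_inj (c : reduction p p') : injective (red_U c).
Proof.
move=> U V e; apply: Uat_inj.
  have := congr1 tag e; case: c e => [a _|m _] /=; [exact: ar_em_inj|exact: mr_em_inj].
exact: (congr1 (@Upos _ p) e).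
Qed.

Lemma UsignE (g : graph At) (x : At * bool) (U : Uat g) :
  Usign U = (nth x (atoms (elabel (tag U))) (Upos U)).2.
Proof. by rewrite /Usign (tnth_nth x). Qed.

Lemma Usign_red (c : reduction p p') U : Usign (red_U c U) = Usign U.
Proof.
pose x := tnth (in_tuple (atoms (elabel (tag U)))) (tagged U).
by rewrite !(UsignE x) (red_elabel c (tag U) : elabel (tag (red_U c U)) = _).
Qed.

Lemma size_red (c : reduction p p') U :
  size (atoms (elabel (tag (red_U c U)))) = size (atoms (elabel (tag U))).
Proof. by rewrite /= red_elabel. Qed.

Lemma mem_red (c : reduction p p') e : e \in red_em c @: setT ->
  forall W : Uat p, tag W = e -> exists U, red_U c U = W.
Proof.
case/imsetP=> e' _ -> W eW.
have lt : (Upos W < size (atoms (elabel e')))%N.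
  by have := Upos_lt W; rewrite eW red_elabel.
by exists (mkU lt); apply: Uat_inj; rewrite ?eW.
Qed.

Lemma concl_red (c : reduction p p') U : concl_atom (red_U c U) = concl_atom U.
Proof.
rewrite /concl_atom /=; case: c => [a|m] /=; first by rewrite -ar_tgt ar_vlab.
have := mr_tgt m (tag U).
have lab v e1 e2 : vlab v = Vtens \/ vlab v = Vpar ->
    ordered_link v e1 e2 (mr_eAB m) \/ ordered_link v e1 e2 (mr_eNBNA m) ->
    forall e, (e == e1) || (e == e2) -> (vlab (tgt e) == Vc) = false.
  move=> lv ol e he; have : e \in premises v.
    by case: ol => -[_ -> _ _ _]; rewrite !inE.
  by rewrite inE => /eqP ->; case: lv => ->.
have labT := lab _ _ _ (or_introl (let: And3 h _ _ := mr_is_tens m in h))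
  (or_introl (let: And3 _ h _ := mr_is_tens m in h)).
have labP := lab _ _ _ (or_intror (let: And3 h _ _ := mr_is_par m in h))
  (or_intror (let: And3 _ h _ := mr_is_par m in h)).
case: ifP => [|_].
  rewrite !inE => h ->; rewrite (mr_k1_cut m).
  by case/orP: h => h; [rewrite labT // h | rewrite labP // h orbT].
case: ifP => [|_ [nk <-]]; last by rewrite mr_vlab.
rewrite !inE => h ->; rewrite (mr_k2_cut m).
by case/orP: h => h; [rewrite labT // h orbT | rewrite labP // h].
Qed.

(** The deleted edges end in a cut link, so no atom of the conclusion is lost. *)
Lemma concl_in_red (c : reduction p p') (W : Uat p) :
  concl_atom W -> exists U, red_U c U = W.
Proof.
move=> cW; apply: (@mem_red c (tag W)) => //.
have nocut v : vlab v = Vcut -> tag W \notin premises v.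
  by move=> vl; rewrite inE; apply: contraTneq cW => e; rewrite /concl_atom e vl.
case: c => [a|m] /=.
  rewrite ar_em_im in_setC; case: (ar_is_cut a) => /nocut + _ hp _ _.
  by rewrite hp.
rewrite mr_em_im in_setC; case: (mr_is_cut m) => /nocut + _ hp _ _.
by rewrite hp.
Qed.

End OneReduction.

Section LinkPairs.
Variables (At : Type) (g : graph At).
Implicit Types (v : vertex g) (U V : Uat g).

Lemma ax_pair v e1 e2 U V : is_ax v e1 e2 -> tag U = e1 -> tag V = e2 ->
  (Upos U + Upos V).+1 = size (atoms (elabel e1)) -> link_pair v U V.
Proof.
case=> lab e12 _ hc _ eU eV sz; rewrite /link_pair lab eU eV sz e12 eqxx andbT.
by rewrite -!in_conclusions hc !inE !eqxx orbT.
Qed.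

Lemma cut_pair v e1 e2 U V : is_cut v e1 e2 -> tag U = e1 -> tag V = e2 ->
  (Upos U + Upos V).+1 = size (atoms (elabel e1)) -> link_pair v U V.
Proof.
case=> lab e12 hc _ _ eU eV sz; rewrite /link_pair lab eU eV sz e12 eqxx andbT.
by rewrite -!in_premises hc !inE !eqxx orbT.
Qed.

Lemma ordered_pairl v e1 e2 e3 U V : ordered_label (vlab v) ->
  ordered_link v e1 e2 e3 -> tag U = e1 -> tag V = e3 -> Upos V = Upos U ->
  link_pair v U V.
Proof.
move=> lab [_ hp l1 _ hc] eU eV sz; move: lab; rewrite /link_pair /ordered_label.
have h1 : tgt e1 == v by rewrite -in_premises hp !inE eqxx.
have h2 : src e3 == v by rewrite -in_conclusions hc inE.
by case: (vlab v) => // _; rewrite eU eV l1 sz h1 h2 eqxx.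
Qed.

Lemma ordered_pairr v e1 e2 e3 U V : ordered_label (vlab v) ->
  ordered_link v e1 e2 e3 -> tag U = e2 -> tag V = e3 ->
  (Upos V + size (atoms (elabel e2)) = Upos U + size (atoms (elabel e3)))%N ->
  link_pair v U V.
Proof.
move=> lab [_ hp _ l2 hc] eU eV sz; move: lab; rewrite /link_pair /ordered_label.
have h1 : tgt e2 == v by rewrite -in_premises hp !inE eqxx orbT.
have h2 : src e3 == v by rewrite -in_conclusions hc inE.
by case: (vlab v) => // _; rewrite eU eV (negbTE l2) sz h1 h2 eqxx.
Qed.

Lemma link_pair_sim (k : fieldType) : is_proof_structure g ->
  forall v U V, link_pair v U V -> sim k g U V.
Proof. by move=> wf v U V h; apply/(simP wf); exists v; rewrite /linked h. Qed.

End LinkPairs.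

(** The two edges deleted by an [a]-redex are crossed between the source of
    [e1] and [e3]. *)
Section AxiomReduction.
Variables (k : fieldType) (At : Type) (p p' : proof_structure At).
Variable a : a_reduction p p'.
Let c := Reda a.
Let Q : pred (Uat p) := fun W => W \in codom (red_U c).

(** Where an atom of the reduct is attached, in the original structure, to the
    link it is a conclusion of. *)
Let source_atom (U : Uat p') (V : Uat p) : Prop :=
  tag V = (if ar_em a (tag U) == ar_e3 a then ar_e1 a else ar_em a (tag U)) /\
  Upos V = Upos U.

Let e3_size : size (atoms (elabel (ar_e3 a))) = size (atoms (elabel (ar_e1 a))).
Proof.
have [_ _ _ _ l2] := ar_is_cut a; have [_ _ _ _ l3] := ar_is_ax a.
by rewrite l3 l2 !size_atoms_fneg.
Qed.

Let source_size U V : source_atom U V ->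
  size (atoms (elabel (tag V))) = size (atoms (elabel (tag U))).
Proof.
case=> -> _; rewrite -(ar_elabel a); case: eqP => // ->.
by rewrite e3_size.
Qed.

Let source_ex U : exists V, source_atom U V.
Proof.
rewrite /source_atom; case: eqP => [e3|_]; last by exists (red_U c U).
have lt : (Upos U < size (atoms (elabel (ar_e1 a))))%N.
  by rewrite -e3_size -e3 ar_elabel; apply: Upos_lt.
by exists (mkU lt).
Qed.

Let source_walk U V X : source_atom U V -> walk k Q X V -> walk k Q X (red_U c U).
Proof.
rewrite /source_atom; case: eqP => [e3|_]; last first.
  by case=> e1 e2; suff -> : V = red_U c U by []; apply: Uat_inj; rewrite ?e1 ?e2.
case=> e1 eV XV.
have notQ W : tag W \in [set ar_e1 a; ar_e2 a] -> ~~ Q W.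
  move=> hW; apply/negP => /codomP[W' eW]; subst W.
  have : ar_em a (tag W') \in ar_em a @: setT by apply: imset_f.
  by rewrite ar_em_im in_setC hW.
have [_ _ _ _ l2] := ar_is_cut a.
have hV := Upos_lt V; rewrite e1 in hV.
have lt : (size (atoms (elabel (ar_e1 a))) - (Upos V).+1 <
           size (atoms (elabel (ar_e2 a))))%N by rewrite l2 size_atoms_fneg; lia.
pose W := mkU lt.
have VW : sim k p V W.
  apply: (@link_pair_sim _ _ k (@ps_wf _ p) (ar_cut a)).
  by apply: (cut_pair (ar_is_cut a)) => //; rewrite Upos_mkU -addSn subnKC.
have WU : sim k p W (red_U c U).
  apply: (@link_pair_sim _ _ k (@ps_wf _ p) (ar_ax a)).
  apply: (ax_pair (ar_is_ax a)) => //.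
  rewrite l2 size_atoms_fneg Upos_mkU (erefl : Upos (red_U c U) = Upos U) -eV.
  by rewrite -addnS addnC subnKC.
apply: walkS WU; last by apply: notQ; rewrite !inE eqxx orbT.
by apply: walkS VW => //; apply: notQ; rewrite e1 !inE eqxx.
Qed.

Lemma a_walk U V : sim k p' U V -> walk k Q (red_U c U) (red_U c V).
Proof.
suff link v X Y : link_pair v X Y -> walk k Q (red_U c X) (red_U c Y).
  case/(simP (@ps_wf _ p'))=> v /orP[]; first exact: link.
  by move=> /link /walkC.
have srcE Z Z' : source_atom Z Z' -> src (tag Z') = ar_vm a (src (tag Z)).
  by case=> -> _; rewrite ar_src; case: eqP.
have [X' hX] := source_ex X; have [Y' hY] := source_ex Y.
have sX := srcE _ _ hX; have sY := srcE _ _ hY.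
have [tX uX] := hX; have [tY uY] := hY.
have zX := source_size hX; have zY := source_size hY.
have zred Z : size (atoms (elabel (tag (red_U c Z)))) = size (atoms (elabel (tag Z))).
  exact: size_red.
have sim_walk W W' w : link_pair w W W' -> walk k Q W W'.
  by move=> /(link_pair_sim k (@ps_wf _ p)) /walk1.
have tgE Z : tgt (tag (red_U c Z)) = ar_vm a (tgt (tag Z)) by rewrite ar_tgt.
have ord : ordered_label (vlab v) -> link_pair v X Y -> walk k Q (red_U c X) (red_U c Y).
  move=> lab h; apply: source_walk hY (sim_walk _ _ (ar_vm a v) _).
  move: h lab; rewrite /link_pair ar_vlab tgE sY zY zred uY.
  rewrite (erefl : Upos (red_U c X) = Upos X).
  case lv: (vlab v) => // /and3P[/eqP eX /eqP eY +] _;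
    by rewrite eX eY !eqxx (erefl : tag (red_U c X) = ar_em a (tag X))
      ar_isleft ?eX /ordered_label ?lv.
case lv: (vlab v) ord => [|||| ] ord //; last 1 first.
- by rewrite /link_pair lv.
- rewrite /link_pair lv => /and4P[/eqP eX /eqP eY neq sz].
  apply: source_walk hY _; apply: walkC; apply: source_walk hX _; apply: walkC.
  apply: (sim_walk _ _ (ar_vm a v)).
  rewrite /link_pair ar_vlab lv sX sY eX eY zX uX uY sz !eqxx andbT /=.
  rewrite tX tY; have e1 Z : ar_e1 a != ar_em a Z.
    apply/eqP => e; have : ar_em a Z \in ar_em a @: setT by apply: imset_f.
    by rewrite ar_em_im in_setC !inE e eqxx.
  case: (ar_em a (tag X) =P ar_e3 a) => [h|_];
    case: (ar_em a (tag Y) =P ar_e3 a) => [h'|_] //.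
  - by move: neq; rewrite (ar_em_inj (etrans h (esym h'))) eqxx.
  - by rewrite eq_sym e1.
  - by rewrite (inj_eq (ar_em_inj (a := a))).
- rewrite /link_pair lv => /and4P[/eqP eX /eqP eY neq sz].
  apply: (sim_walk _ _ (ar_vm a v)).
  rewrite /link_pair ar_vlab lv !tgE eX eY zred !eqxx /=.
  by rewrite (inj_eq (ar_em_inj (a := a))) neq.
- exact: ord.
- exact: ord.
Qed.

End AxiomReduction.

(** An inserted cut link between [eA] and [eNA] replaces the detour through the
    tensor, the cut and the par link, and similarly for [eB] and [eNB]. *)
Section TensorParReduction.
Variables (k : fieldType) (At : Type) (p p' : proof_structure At).
Variable m : m_reduction p p'.
Let c := Redm m.
Let Q : pred (Uat p) := fun W => W \in codom (red_U c).

Let notQ W : tag W \in [set mr_eAB m; mr_eNBNA m] -> ~~ Q W.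
Proof.
move=> hW; apply/negP => /codomP[W' eW]; subst W.
have : mr_em m (tag W') \in mr_em m @: setT by apply: imset_f.
by rewrite mr_em_im in_setC hW.
Qed.

Let sim_link v (U V : Uat p) : link_pair v U V -> sim k p U V.
Proof. exact: (link_pair_sim k (@ps_wf _ p)). Qed.

Let labT : ordered_label (vlab (mr_tens m)).
Proof. by rewrite /ordered_label; case: (mr_is_tens m) => ->. Qed.

Let labP : ordered_label (vlab (mr_par m)).
Proof. by rewrite /ordered_label; case: (mr_is_par m) => ->. Qed.

Let sizeAB : size (atoms (elabel (mr_eAB m))) =
  (size (atoms (elabel (mr_eA m))) + size (atoms (elabel (mr_eB m))))%N.
Proof. by case: (mr_is_tens m) => _ _ ->; rewrite /= size_cat. Qed.

Let sizeN : size (atoms (elabel (mr_eNBNA m))) =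
  (size (atoms (elabel (mr_eNB m))) + size (atoms (elabel (mr_eNA m))))%N.
Proof. by case: (mr_is_par m) => _ _ ->; rewrite /= size_cat. Qed.

Let sizeN' : size (atoms (elabel (mr_eNBNA m))) = size (atoms (elabel (mr_eAB m))).
Proof. by case: (mr_is_cut m) => _ _ _ _ ->; rewrite size_atoms_fneg. Qed.

Let sizeNA : size (atoms (elabel (mr_eNA m))) = size (atoms (elabel (mr_eA m))).
Proof.
have [_ _ lN] := mr_is_par m; have [_ _ lT] := mr_is_tens m.
have [_ _ _ _] := mr_is_cut m; rewrite lN lT /= => -[_ ->].
exact: size_atoms_fneg.
Qed.

Let cutA_walk (U V : Uat p) : tag U = mr_eA m -> tag V = mr_eNA m ->
  (Upos U + Upos V).+1 = size (atoms (elabel (mr_eA m))) -> walk k Q U V.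
Proof.
move=> eU eV sz.
have lt1 : (Upos U < size (atoms (elabel (mr_eAB m))))%N by rewrite sizeAB; lia.
have lt2 : (size (atoms (elabel (mr_eAB m))) - (Upos U).+1 <
            size (atoms (elabel (mr_eNBNA m))))%N by rewrite sizeN'; lia.
apply: (@walkS _ _ _ _ _ (mkU lt2)); last first.
- rewrite simC; apply: (@sim_link (mr_par m)).
  case: (mr_is_par m) => _ ol _; apply: ordered_pairr labP ol eV _ _ => //.
  rewrite Upos_mkU; have := sizeN; have := sizeN'; have := sizeNA; lia.
- by apply: notQ; rewrite !inE eqxx orbT.
apply: (@walkS _ _ _ _ _ (mkU lt1)); last first.
- apply: (@sim_link (mr_cut m)); apply: (cut_pair (mr_is_cut m)) => //.
  by rewrite !Upos_mkU; lia.
- by apply: notQ; rewrite !inE eqxx.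
apply: walk1; apply: (@sim_link (mr_tens m)).
by case: (mr_is_tens m) => _ ol _; apply: ordered_pairl labT ol eU _ _.
Qed.

Let cutB_walk (U V : Uat p) : tag U = mr_eB m -> tag V = mr_eNB m ->
  (Upos U + Upos V).+1 = size (atoms (elabel (mr_eB m))) -> walk k Q U V.
Proof.
move=> eU eV sz.
have lt1 : (size (atoms (elabel (mr_eA m))) + Upos U <
            size (atoms (elabel (mr_eAB m))))%N by rewrite sizeAB; lia.
have lt2 : (Upos V < size (atoms (elabel (mr_eNBNA m))))%N.
  by rewrite sizeN' sizeAB; lia.
apply: (@walkS _ _ _ _ _ (mkU lt2)); last first.
- rewrite simC; apply: (@sim_link (mr_par m)).
  by case: (mr_is_par m) => _ ol _; apply: ordered_pairl labP ol eV _ _.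
- by apply: notQ; rewrite !inE eqxx orbT.
apply: (@walkS _ _ _ _ _ (mkU lt1)); last first.
- apply: (@sim_link (mr_cut m)); apply: (cut_pair (mr_is_cut m)) => //.
  by rewrite !Upos_mkU sizeAB; lia.
- by apply: notQ; rewrite !inE eqxx.
apply: walk1; apply: (@sim_link (mr_tens m)).
case: (mr_is_tens m) => _ ol _; apply: ordered_pairr labT ol eU _ _ => //.
by rewrite Upos_mkU sizeAB; lia.
Qed.

Let tgt_k1 e : tgt e = mr_k1 m -> mr_em m e = mr_eA m \/ mr_em m e = mr_eNA m.
Proof.
have := mr_tgt m e; case: ifP => [|_].
  by rewrite !inE => /orP[]/eqP; [left|right].
case: ifP => [_ ->|_ [+ _ e1]] //.
  by move=> /eqP; rewrite eq_sym (negbTE (mr_k_neq m)).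
by rewrite e1 !inE eqxx.
Qed.

Let tgt_k2 e : tgt e = mr_k2 m -> mr_em m e = mr_eB m \/ mr_em m e = mr_eNB m.
Proof.
have := mr_tgt m e; case: ifP => [_ ->|_].
  by move=> /eqP; rewrite (negbTE (mr_k_neq m)).
case: ifP => [|_ [+ _ e1]].
  by rewrite !inE => /orP[]/eqP -> _ _; [left|right].
by rewrite e1 !inE eqxx orbT.
Qed.

Lemma m_walk U V : sim k p' U V -> walk k Q (red_U c U) (red_U c V).
Proof.
suff link v X Y : link_pair v X Y -> walk k Q (red_U c X) (red_U c Y).
  case/(simP (@ps_wf _ p'))=> v /orP[]; first exact: link.
  by move=> /link /walkC.
have zred Z : size (atoms (elabel (tag (red_U c Z)))) = size (atoms (elabel (tag Z))).
  exact: size_red.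
have em_inj (Z W : Uat p') : tag Z != tag W -> mr_em m (tag Z) <> mr_em m (tag W).
  by move=> /eqP h /mr_em_inj.
have [->|n1] := eqVneq v (mr_k1 m).
  move=> h; have := h.
  rewrite /link_pair mr_k1_cut => /and4P[/eqP tX /eqP tY neq /eqP sz].
  have := em_inj _ _ neq.
  case: (tgt_k1 tX) => eX; case: (tgt_k1 tY) => eY; rewrite eX eY // => _.
    by apply: cutA_walk => //; rewrite sz -zred /= eX.
  apply: walkC; apply: cutA_walk => //.
  by rewrite addnC sz -zred /= eX sizeNA.
have [->|n2] := eqVneq v (mr_k2 m).
  move=> h; have := h.
  rewrite /link_pair mr_k2_cut => /and4P[/eqP tX /eqP tY neq /eqP sz].
  have sizeNB : size (atoms (elabel (mr_eNB m))) = size (atoms (elabel (mr_eB m))).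
    have := sizeN; have := sizeAB; have := sizeN'; have := sizeNA; lia.
  have := em_inj _ _ neq.
  case: (tgt_k2 tX) => eX; case: (tgt_k2 tY) => eY; rewrite eX eY // => _.
    by apply: cutB_walk => //; rewrite sz -zred /= eX.
  apply: walkC; apply: cutB_walk => //.
  by rewrite addnC sz -zred /= eX sizeNB.
have nv : v \notin [set mr_k1 m; mr_k2 m] by rewrite !inE negb_or n1.
have srcE Z : src (tag Z) = v -> src (tag (red_U c Z)) = mr_vm m v.
  by move=> <-; case: (mr_src m (tag Z)).
have tgtE Z : tgt (tag Z) = v -> tgt (tag (red_U c Z)) = mr_vm m v.
  move=> ez; have := mr_tgt m (tag Z); rewrite ez.
  case: ifP => [_ e|_]; first by rewrite e eqxx in n1.
  by case: ifP => [_ e|_ [_ ->]] //; rewrite e eqxx in n2.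
move=> h; apply: walk1; apply: (@sim_link (mr_vm m v)); move: h.
rewrite /link_pair (mr_vlab nv) !zred.
have tag_neq : tag X != tag Y -> tag (red_U c X) != tag (red_U c Y).
  by move=> neq; apply/eqP/em_inj.
case lv: (vlab v) => //.
- by move=> /and4P[/eqP/srcE -> /eqP/srcE -> /tag_neq -> ->]; rewrite !eqxx.
- by move=> /and4P[/eqP/tgtE -> /eqP/tgtE -> /tag_neq -> ->]; rewrite !eqxx.
- move=> /and3P[/eqP tX /eqP sY]; rewrite (tgtE _ tX) (srcE _ sY) !eqxx /=.
  by rewrite mr_isleft // tX /ordered_label lv.
- move=> /and3P[/eqP tX /eqP sY]; rewrite (tgtE _ tX) (srcE _ sY) !eqxx /=.
  by rewrite mr_isleft // tX /ordered_label lv.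
Qed.

End TensorParReduction.

(** * Reduction sequences *)

Section ReductionSequences.
Variables (k : fieldType) (At : Type).

Fixpoint seq_U (p p' : proof_structure At) (Gam : reduction_seq p p') :
    Uat p' -> Uat p :=
  match Gam with
  | RedOne _ _ c => red_U c
  | RedCons _ _ _ c Gam' => fun U => red_U c (seq_U Gam' U)
  end.

Lemma Tseq_Xvar p p' (Gam : reduction_seq p p') U :
  Tseq Gam (Xvar k U) = Xvar k (seq_U Gam U).
Proof.
elim: Gam U => [? ? c|? ? ? c Gam IH] U /=; first exact: Tred_Xvar.
by rewrite IH Tred_Xvar.
Qed.

Lemma TseqB p p' (Gam : reduction_seq p p') :
  {morph @Tseq k At p p' Gam : f h / f - h}.
Proof.
elim: Gam => [? ? c|? ? ? c Gam IH] f h /=; first exact: comp_mpolyB.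
by rewrite IH; apply: comp_mpolyB.
Qed.

Lemma meval_Tseq p p' (Gam : reduction_seq p p') (h : P_[k] p') (v : Uat p -> k) :
  (Tseq Gam h).@[fun i => v (enum_val i)] =
  h.@[fun i => v (seq_U Gam (enum_val i))].
Proof.
have red q q' (c : reduction q q') (f : P_[k] q') (w : Uat q -> k) :
    (Tred c f).@[fun i => w (enum_val i)] =
    f.@[fun i => w (red_U c (enum_val i))].
  rewrite /Tred comp_mpoly_meval; apply: meval_eq => i.
  by rewrite tnth_mktuple /Xvar mevalXU enum_rankK.
elim: Gam h v => [? ? c|? ? ? c Gam IH] h v /=; first exact: red.
by rewrite red (IH _ (fun U => v (red_U c U))).
Qed.

Lemma seq_U_inj p p' (Gam : reduction_seq p p') : injective (seq_U Gam).
Proof.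
elim: Gam => [? ? c|? ? ? c Gam IH] U V /=; first exact: red_U_inj.
by move=> /red_U_inj /IH.
Qed.

Lemma in_imageE p p' (Gam : reduction_seq p p') U :
  in_image k Gam U = (U \in codom (seq_U Gam)).
Proof.
have Xinj (V W : Uat p) : Xvar k V = Xvar k W -> V = W.
  rewrite /Xvar => /(congr1 (mcoeff U_(enum_rank W))); rewrite !mcoeffX eqxx.
  case: eqP => [/mnmP /(_ (enum_rank W))|_ /eqP]; last by rewrite eq_sym oner_eq0.
  by rewrite !mnm1E eqxx; case: eqP => // /enum_rank_inj.
apply/existsP/codomP => -[U' h]; exists U'.
  by move/eqP: h; rewrite Tseq_Xvar => /Xinj.
by rewrite Tseq_Xvar h.
Qed.

Lemma Usign_seq p p' (Gam : reduction_seq p p') U : Usign (seq_U Gam U) = Usign U.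
Proof.
elim: Gam U => [? ? c|? ? ? c Gam IH] U; first exact: Usign_red.
by rewrite -IH; apply: Usign_red.
Qed.

Lemma concl_seq p p' (Gam : reduction_seq p p') U :
  concl_atom (seq_U Gam U) = concl_atom U.
Proof.
elim: Gam U => [? ? c|? ? ? c Gam IH] U; first exact: concl_red.
by rewrite -IH; apply: concl_red.
Qed.

Lemma concl_in_seq p p' (Gam : reduction_seq p p') (W : Uat p) :
  concl_atom W -> exists U, seq_U Gam U = W.
Proof.
elim: Gam W => [? ? c|? ? ? c Gam IH] W cW; first exact: concl_in_red.
have [V eV] := concl_in_red c cW; rewrite -eV concl_red in cW.
by have [U eU] := IH V cW; exists U; rewrite /= eU.
Qed.

Lemma red_walk (p p' : proof_structure At) (c : reduction p p') U V : sim k p' U V ->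
  walk k (fun W => W \in codom (red_U c)) (red_U c U) (red_U c V).
Proof. by case: c => [a|m]; [apply: a_walk | apply: m_walk]. Qed.

Lemma sub_walk (g : graph At) (Q Q' : pred (Uat g)) U V :
  (forall W, Q W -> Q' W) -> walk k Q' U V -> walk k Q U V.
Proof.
move=> sub; elim=> {V} [V|V W _ IH QV]; first exact: walk1.
by apply: walkS IH _; apply: contra QV; apply: sub.
Qed.

(** Chains compose: an atom inside a chain of an intermediate structure is
    deleted later on, so its image is not a survivor of the whole sequence. *)
Lemma seq_walk (p p' : proof_structure At) (Gam : reduction_seq p p') U V : sim k p' U V ->
  walk k (fun W => W \in codom (seq_U Gam)) (seq_U Gam U) (seq_U Gam V).
Proof.
elim: Gam U V => [? ? c|q r s c Gam IH] U V; first exact: red_walk.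
move=> /IH /=; move: (seq_U Gam U) (seq_U Gam V) => X Y.
have step X1 X2 : sim k r X1 X2 ->
    walk k (fun W => W \in codom (fun U => red_U c (seq_U Gam U)))
      (red_U c X1) (red_U c X2).
  move=> /(red_walk c); apply: sub_walk => W /codomP[Z ->]; exact: codom_f.
elim=> {Y} [Y|Y Z _ IHY QY YZ]; first exact: step.
apply: walk_trans IHY _ (step _ _ YZ).
apply: contra QY => /codomP[W /red_U_inj ->]; exact: codom_f.
Qed.

End ReductionSequences.

(** * Consecutive surviving atoms of a path *)

Section Survivors.
Variables (k : fieldType) (At : Type) (g : graph At).
Hypothesis wf : is_proof_structure g.
Variable Ps : seq (seq (Uat g)).
Hypothesis hPs : persistent_paths k Ps.
Variable Q : pred (Uat g).
Hypothesis concl_Q : forall V, concl_atom V -> Q V.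
Implicit Types U V W X Y : Uat g.
Notation pos := (pos Ps).
Notation nxt := (nxt k Ps).

(** Runs cut the paths into stretches, each starting with its only atom in [Q];
    every atom [Y] belongs to exactly one of them ([run_ex], [run_fun]). *)
Inductive run X : Uat g -> Prop :=
  | run0 : Q X -> run X X
  | runS Y Y' : run X Y -> nxt Y Y' -> ~~ Q Y' -> run X Y'.

(** The atom of [Q] that follows [X] once the atoms outside [Q] are erased from
    the path. *)
Definition next_in X Y : Prop := Q Y /\ exists2 Z, run X Z & nxt Z Y.

Lemma nxt_pos X Y : nxt X Y -> pos Y = (pos X).+1.
Proof. by case/andP=> _ /eqP. Qed.

Lemma prev_ex Y : ~~ Q Y -> exists X, nxt X Y.
Proof.
move=> QY; case: (concl_or_prev wf hPs Y) => // /andP[/concl_Q].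
by rewrite (negbTE QY).
Qed.

Lemma run_ex Y : exists X, run X Y.
Proof.
have [n le] := ubnP (pos Y); elim: n Y le => // n IH Y le.
have [QY|QY] := boolP (Q Y); first by exists Y; apply: run0.
have [Z ZY] := prev_ex QY; have [|X XZ] := IH Z; first by rewrite (nxt_pos ZY) in le.
by exists X; apply: runS XZ ZY QY.
Qed.

Lemma run_start X Y : run X Y -> Q X.
Proof. by elim. Qed.

Lemma run_in X Y : run X Y -> Q Y -> Y = X.
Proof. by case=> // Z Z' _ _ /negbTE ->. Qed.

Lemma run_prev X Y Z : run X Y -> ~~ Q Y -> nxt Z Y -> run X Z.
Proof. by case=> [->//|Y' Y'' XY' h _ _ /(nxt_inj hPs h) <-]. Qed.

Lemma run_fun X X' Y : run X Y -> run X' Y -> X = X'.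
Proof.
elim=> {Y} [QX h|Y Y' _ IH YY' QY' h]; first exact: run_in h QX.
exact/IH/(run_prev h QY' YY').
Qed.

Lemma run_pos X Y : run X Y -> (pos X <= pos Y)%N.
Proof. by elim=> {Y} // Y Y' _ le /nxt_pos -> _; apply: leqW. Qed.

Lemma run_between X Y W : run X Y -> (pos X < pos W <= pos Y)%N -> ~~ Q W.
Proof.
elim=> {Y} [_|Y Y' _ IH YY' QY']; first by case: ltngtP.
rewrite (nxt_pos YY') => /andP[lt]; rewrite leq_eqVlt => /orP[/eqP|le].
  by rewrite -(nxt_pos YY') => /(pos_inj hPs) ->.
by apply: IH; rewrite lt.
Qed.

Lemma next_in_start X Y : next_in X Y -> Q X.
Proof. by case=> _ [Z /run_start]. Qed.

Lemma next_in_pos X Y : next_in X Y -> (pos X < pos Y)%N.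
Proof. by case=> _ [Z /run_pos le /nxt_pos ->]. Qed.

Lemma next_in_fun X Y Y' : next_in X Y -> next_in X Y' -> Y = Y'.
Proof.
have half Z Z' : next_in X Z -> next_in X Z' -> (pos Z <= pos Z')%N.
  move=> nZ [QZ' [W XW WZ']]; rewrite leqNgt; apply/negP => lt.
  case: nZ => _ [V XV VZ]; have := run_between (W := Z') XV.
  rewrite QZ' (nxt_pos WZ') ltnS (run_pos XW) => /(_ _)/negP; apply=> //=.
  by move: lt; rewrite (nxt_pos WZ') (nxt_pos VZ).
by move=> h h'; apply: (pos_inj hPs); apply/eqP; rewrite eqn_leq !half.
Qed.

Lemma next_in_inj X X' Y : next_in X Y -> next_in X' Y -> X = X'.
Proof.
move=> [_ [Z XZ ZY]] [_ [Z' X'Z' Z'Y]].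
by apply: run_fun XZ _; rewrite (nxt_inj hPs ZY Z'Y).
Qed.

Lemma nxt_next_in X Y : Q X -> Q Y -> nxt X Y -> next_in X Y.
Proof. by move=> QX QY XY; split=> //; exists X => //; apply: run0. Qed.

(** Inside a maximal stretch of atoms outside [Q] all runs start at the same
    atom, so that a walk can leave the stretch only at its two ends. *)
Lemma walk_next_in X Y : Q X -> Q Y -> X != Y -> walk k Q X Y ->
  next_in X Y \/ next_in Y X.
Proof.
move=> QX QY XY w.
have exit Z W S : run S Z -> ~~ Q Z -> sim k g Z W -> Q W -> W = S \/ next_in S W.
  move=> SZ QZ /(sim_pos wf hPs)[ZW|WZ] QW; first by right; split=> //; exists Z.
  by left; apply: run_in QW; apply: run_prev SZ QZ WZ.
(* The first step of the walk reaches [Y] directly or enters a run, starting at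
   some [S], which the walk does not leave before [Y]. *)
suff [[QY' _]|[[h _]|[S SY out]]] :
    (~~ Q Y /\ exists2 S, run S Y & X = S \/ next_in S X) \/
    (sim k g X Y /\ Q Y) \/ exists2 S, (Y = S \/ next_in S Y) & (X = S \/ next_in S X).
- by rewrite QY in QY'.
- by case: (sim_pos wf hPs h) => h'; [left|right]; apply: nxt_next_in.
- case: SY out => [eY|nY] [eX|nX].
  + by rewrite eX eY eqxx in XY.
  + by right; rewrite eY.
  + by left; rewrite eX.
  + by rewrite (next_in_fun nX nY) eqxx in XY.
elim: {Y} w {QY XY} => [Y XY|Y Z _ IH QY YZ].
  have [QY|QY] := boolP (Q Y); first by right; left.
  left; split=> //; have [S SY] := run_ex Y; exists S => //.
  by apply: exit SY QY _ QX; rewrite simC.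
case: IH => [[_ [S SY out]]|[[_ QY']|[S SY' out]]].
- have [QZ|QZ] := boolP (Q Z).
    by right; right; exists S => //; apply: exit SY QY YZ QZ.
  left; split=> //; exists S => //.
  case: (sim_pos wf hPs YZ) => [YZ'|ZY]; first exact: runS SY YZ' QZ.
  exact: run_prev SY QY ZY.
- by rewrite QY' in QY.
- case: SY' => [eY|[QY' _]]; last by rewrite QY' in QY.
  case: out => [eX|nX]; first by rewrite eY -eX QX in QY.
  by rewrite eY (next_in_start nX) in QY.
Qed.

End Survivors.

(** * Binomials for a lexicographic order *)

Lemma submm n (m : 'X_{1..n}) : (m - m)%MM = 0%MM.
Proof. by apply/mnmP => i; rewrite mnmBE mnm0E subnn. Qed.

Section LexBinomials.
Variables (k : fieldType) (At : Type) (g : graph At) (s : seq (Uat g)).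
Hypothesis mem_s : forall U, U \in s.
Implicit Types (U V W : Uat g) (f : P_[k] g) (G : seq (P_[k] g)).
Notation lt := (lex_lt s).
Notation Xm U := (U_(enum_rank U))%MM.

Definition bin V U : P_[k] g := Xvar k V - Xvar k U.

Lemma seq_lt_total U V : U != V -> seq_lt s U V || seq_lt s V U.
Proof.
apply: contraNT; rewrite negb_or /seq_lt -!leqNgt -eqn_leq => /eqP e.
by apply/eqP; rewrite -(nth_index U (mem_s U)) -e nth_index.
Qed.

Lemma seq_lt_neq U V : seq_lt s U V -> U != V.
Proof. by apply: contraTneq => ->; rewrite /seq_lt ltnn. Qed.

Lemma seq_lt_asym U V : seq_lt s U V -> ~~ seq_lt s V U.
Proof. by rewrite /seq_lt -leqNgt => /ltnW. Qed.

Lemma XmE U V : Xm U (enum_rank V) = (U == V).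
Proof. by rewrite mnm1E (inj_eq enum_rank_inj). Qed.

Lemma Xm_inj U V : Xm U = Xm V -> U = V.
Proof. by move/mnmP/(_ (enum_rank V)); rewrite !XmE eqxx; case: eqP. Qed.

Lemma lex_ltXX U V : lt (Xm U) (Xm V) = seq_lt s U V.
Proof.
apply/existsP/idP => [[W /andP[]]|UV].
  rewrite !XmE => h /forallP/(_ U); rewrite !XmE eqxx => /implyP.
  have -> : W = V by case: (V =P W) h => //; case: (U == W).
  have UV : U != V by apply: contraTneq h => ->; rewrite ltnn.
  by case/orP: (seq_lt_total UV) => // VU /(_ VU); rewrite (eq_sym V) (negbTE UV).
exists V; rewrite !XmE eqxx (negbTE (seq_lt_neq UV)) /=.
apply/forallP => W; apply/implyP => VW; rewrite !XmE (negbTE (seq_lt_neq VW)).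
have : U != W by apply/seq_lt_neq/ltn_trans/VW.
by move/negbTE->.
Qed.

Lemma lex_lt0X U : lt 0%MM (Xm U).
Proof.
apply/existsP; exists U; rewrite XmE eqxx mnm0E /=.
apply/forallP => W; apply/implyP => /seq_lt_neq /negbTE UW.
by rewrite XmE mnm0E UW.
Qed.

Lemma lepXX U V : (Xm U <= Xm V)%MM = (U == V).
Proof.
apply/mnm_lepP/eqP => [/(_ (enum_rank U))|-> //].
by rewrite !XmE eqxx; case: eqP.
Qed.

Lemma msupp_bin (c : k) V U : c != 0 -> U != V ->
  msupp (c *: bin V U) =i [:: Xm V; Xm U].
Proof.
move=> c0 UV m; rewrite mcoeff_msupp mcoeffZ mulf_eq0 (negbTE c0) /=.
rewrite mcoeffB !mcoeffX !inE !(eq_sym m).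
case: (Xm V =P m) => [e1|_]; case: (Xm U =P m) => [e2|_] /=.
- by move: UV; rewrite (Xm_inj (etrans e2 (esym e1))) eqxx.
- by rewrite subr0 oner_eq0.
- by rewrite sub0r oppr_eq0 oner_eq0.
- by rewrite subr0 eqxx.
Qed.

Lemma LM_bin (c : k) V U : c != 0 -> seq_lt s U V -> LM lt (c *: bin V U) = Xm V.
Proof.
move=> c0 UV; have := msupp_bin c0 (seq_lt_neq UV); rewrite /LM.
have ltVV : lt (Xm V) (Xm V) = false by rewrite lex_ltXX /seq_lt ltnn.
have ltVU : lt (Xm V) (Xm U) = false.
  by rewrite lex_ltXX; apply/negbTE/seq_lt_asym.
move: (msupp _) => l el.
have {el} : {subset l <= [:: Xm V; Xm U]} /\ Xm V \in l.
  by split=> [m|]; rewrite el // mem_head.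
(* The maximum is computed from the monomial 1, which is below every variable
   and remains the value as long as no monomial has been met. *)
suff H : {subset l <= [:: Xm V; Xm U]} ->
    let m := foldr (fun m m' => if lt m' m then m else m') 0%MM l in
    m \in [:: Xm V; Xm U; 0%MM] /\ (Xm V \in l -> m = Xm V).
  by case=> /H[_ h] /h.
elim: l => [|m l IH] sub /=; first by rewrite !inE eqxx !orbT.
have [|memF eF] := IH; first by move=> x xl; apply: sub; rewrite inE xl orbT.
have mVU : m \in [:: Xm V; Xm U] by apply: sub; rewrite mem_head.
set F := foldr _ _ _ in memF eF *; split.
  by case: ifP => _ //; move: mVU; rewrite !inE orbA => ->.
rewrite inE => /predU1P[eV|/eF ->]; last first.
  by move: mVU; rewrite !inE => /orP[/eqP ->|/eqP ->]; rewrite ?ltVV ?ltVU.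
rewrite -eV; move: memF; rewrite !inE => /or3P[]/eqP->.
- by rewrite ltVV.
- by rewrite lex_ltXX UV.
- by rewrite lex_lt0X.
Qed.

Lemma bin_neq0 (c : k) V U : c != 0 -> U != V -> c *: bin V U != 0.
Proof.
move=> c0 UV; rewrite -msupp_eq0; apply/eqP => e.
by have := msupp_bin c0 UV (Xm V); rewrite e mem_head.
Qed.

Lemma LC_bin (c : k) V U : c != 0 -> seq_lt s U V -> LC lt (c *: bin V U) = c.
Proof.
move=> c0 UV; rewrite /LC LM_bin // mcoeffZ mcoeffB !mcoeffX eqxx.
have -> : (Xm U == Xm V) = false.
  by apply: contraNF (seq_lt_neq UV) => /eqP/Xm_inj ->.
by rewrite subr0 mulr1.
Qed.

Lemma bin_opp c V U : c *: bin V U = (- c) *: bin U V.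
Proof. by rewrite /bin scaleNr -scalerN opprB. Qed.

Lemma LM_bin1 V U : seq_lt s U V -> LM lt (bin V U) = Xm V.
Proof. by move=> UV; rewrite -[bin V U]scale1r LM_bin ?oner_eq0. Qed.

Lemma LC_bin1 V U : seq_lt s U V -> LC lt (bin V U) = 1.
Proof. by move=> UV; rewrite -[bin V U]scale1r LC_bin ?oner_eq0. Qed.

Lemma bin_reduce (c : k) V U U' : c != 0 -> seq_lt s U V -> seq_lt s U' V ->
  c *: bin V U - LTquo lt (c *: bin V U) (bin V U') * bin V U' = c *: bin U' U.
Proof.
move=> c0 UV U'V.
rewrite /LTquo LC_bin // LC_bin1 // LM_bin // LM_bin1 // submm mpolyX0.
rewrite divr1 -scalerAl mul1r -scalerBr; congr (_ *: _).
by rewrite /bin opprB addrC addrA subrK.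
Qed.

Lemma Spoly_bin V U U' : seq_lt s U V -> seq_lt s U' V ->
  Spoly lt (bin V U) (bin V U') = bin U' U.
Proof.
move=> UV U'V; rewrite /Spoly /Lcm !LC_bin1 // !LM_bin1 // invr1 !scale1r.
have -> : mlcm (Xm V) (Xm V) = Xm V by rewrite mlcmE submm addm0.
rewrite submm mpolyX0 !mul1r /bin opprB addrC addrA subrK //.
Qed.

End LexBinomials.

(** * The order putting the surviving atoms first *)

Lemma index_filter_lt (T : eqType) (Q : pred T) (l : seq T) x y :
  uniq l -> x \in l -> y \in l -> Q x -> Q y -> (index x l < index y l)%N ->
  (index x (filter Q l) < index y (filter Q l))%N.
Proof.
move=> + + + Qx Qy; elim: l => //= a l IH /andP[al ul]; rewrite !inE.
have [->|xa] := eqVneq a x.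
  by move=> _ _; rewrite Qx /= eqxx; case: (x =P y).
have [->|ya] := eqVneq a y; first by rewrite ltn0.
rewrite ltnS /= => xl yl h; have {}IH := IH ul xl yl h.
by case: ifP => _ //=; rewrite (negbTE xa) (negbTE ya) ltnS.
Qed.

Section Elimination.
Variables (k : fieldType) (At : Type) (g : graph At).
Hypothesis wf : is_proof_structure g.
Variable Ps : seq (seq (Uat g)).
Hypothesis hPs : persistent_paths k Ps.
Variable Q : pred (Uat g).
Hypothesis concl_Q : forall V, concl_atom V -> Q V.
Implicit Types (U V W X Y : Uat g) (f : P_[k] g) (G : seq (P_[k] g)).
Notation pos := (pos Ps).
Notation nxt := (nxt k Ps).
Notation run := (run k Ps Q).
Notation next_in := (next_in k Ps Q).
Notation bin := (bin k).

Definition elim_order : seq (Uat g) :=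
  [seq U <- flatten Ps | Q U] ++ [seq U <- flatten Ps | ~~ Q U].

Notation s := elim_order.
Notation "U <s V" := (seq_lt s U V) (at level 70).
Notation lt := (lex_lt s).

Lemma mem_elim_order U : U \in s.
Proof.
by rewrite mem_cat !mem_filter (mem_flatten_paths hPs) !andbT orbN.
Qed.

Lemma uniq_elim_order : uniq s.
Proof.
rewrite cat_uniq !filter_uniq ?(uniq_flatten_paths wf hPs) // andbT /=.
by apply/hasPn => U; rewrite !mem_filter => /andP[/negbTE ->].
Qed.

Lemma elim_lt_cross U V : Q U -> ~~ Q V -> U <s V.
Proof.
move=> QU QV; rewrite /seq_lt !index_cat !mem_filter !(mem_flatten_paths hPs).
rewrite QU (negbTE QV) /=; apply: ltn_addr; rewrite index_mem.
by rewrite mem_filter QU (mem_flatten_paths hPs).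
Qed.

Lemma elim_lt_pos U V : Q U = Q V -> (pos U < pos V)%N -> U <s V.
Proof.
move=> QUV lt; have [uF mF] := (uniq_flatten_paths wf hPs, mem_flatten_paths hPs).
rewrite /seq_lt !index_cat !mem_filter !mF -QUV !andbT; case: ifP => QU.
  by apply: index_filter_lt; rewrite // -QUV.
by rewrite ltn_add2l; apply: index_filter_lt; rewrite // -?QUV ?QU.
Qed.

Lemma next_in_lt U V : next_in U V -> U <s V.
Proof.
move=> UV; apply: elim_lt_pos (next_in_pos UV).
by rewrite (next_in_start UV); case: UV.
Qed.

Lemma nxt_lt U V : nxt U V -> ~~ Q V -> U <s V.
Proof.
move=> UV QV; have [QU|QU] := boolP (Q U); first exact: elim_lt_cross.
by apply: elim_lt_pos; rewrite ?(negbTE QU) ?(negbTE QV) ?(nxt_pos UV).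
Qed.

(** * Division by the binomials met during the algorithm *)

(** The binomials that can occur in the list maintained by the algorithm, with
    leading variable [V]. *)
Definition leads f V : Prop :=
  exists U, [/\ f = bin V U, U <s V & sim k g U V \/ next_in U V].

Lemma leads_LM f V : leads f V -> LM lt f = U_(enum_rank V)%MM.
Proof. by case=> U [-> UV _]; apply: LM_bin1 => //; exact: mem_elim_order. Qed.

Lemma leads_neq0 f V : leads f V -> f != 0.
Proof.
case=> U [-> /seq_lt_neq UV _].
by rewrite -[bin V U]scale1r bin_neq0 ?oner_eq0.
Qed.

Lemma leads_in f V : Q V -> leads f V -> exists2 U, next_in U V & f = bin V U.
Proof.
move=> QV [U [-> UV [h|h]]]; exists U => //.
have QU : Q U.
  by apply: contraTT UV => QU; apply/seq_lt_asym/elim_lt_cross.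
case: (sim_pos wf hPs h) => h'; first exact: nxt_next_in.
by case/negP: (seq_lt_asym UV); apply/next_in_lt/nxt_next_in.
Qed.

Lemma leads_out f V : ~~ Q V -> leads f V ->
  (exists2 U, nxt U V & f = bin V U) \/
  (exists U, [/\ nxt V U, Q U & f = bin V U]).
Proof.
move=> QV [U [-> UV [h|[]]]]; last by rewrite (negbTE QV).
case: (sim_pos wf hPs h) => h'; first by left; exists U.
right; exists U; split=> //; apply: contraTT UV => QU.
by apply: seq_lt_asym; apply: nxt_lt.
Qed.

Definition admissible G : Prop := forall f, f \in G -> exists V, leads f V.

Definition all_links G : Prop :=
  forall U V, sim k g U V -> U <s V -> bin V U \in G.

Lemma find_leads G h V : admissible G -> LM lt h = U_(enum_rank V)%MM ->
  has (fun f => LTdvd lt f h) G ->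
  let f := G`_(find (fun f => LTdvd lt f h) G) in f \in G /\ leads f V.
Proof.
move=> adm LMh hasG f; have fG : f \in G by rewrite mem_nth // -has_find.
split=> //; have [W fW] := adm f fG.
have /andP[_] : LTdvd lt f h by exact: (nth_find 0 hasG).
by rewrite LMh (leads_LM fW) lepXX => /eqP <-.
Qed.

Lemma leads_has G h V f : LM lt h = U_(enum_rank V)%MM -> f \in G -> leads f V ->
  has (fun f => LTdvd lt f h) G.
Proof.
move=> LMh fG fV; apply/hasP; exists f => //.
by rewrite /LTdvd (leads_neq0 fV) LMh (leads_LM fV) lepXX eqxx.
Qed.

(** The division descends the run one atom at a time: as the successor of [Y] is
    outside [Q], hence larger, a binomial led by [Y] can only contain the
    predecessor of [Y]. At the start [X] of the run the leading variable becomes [X'],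
    and the division stops there unless [X' - X] is already present. *)
Lemma div_run G X Y X' (c : k) : admissible G -> all_links G -> c != 0 ->
  next_in X X' -> run X Y -> (~~ Q Y -> forall Z, nxt Y Z -> ~~ Q Z) ->
  exists2 r, div_es lt G (c *: bin Y X') r
    & (r = 0 /\ bin X' X \in G) \/ (r = c *: bin X X' /\ bin X' X \notin G).
Proof.
move=> adm links c0 XX'; elim=> {Y} [QX _|Y Y' XY IH YY' QY' out].
  rewrite bin_opp; have ltX := next_in_lt XX'.
  have c0' : - c != 0 by rewrite oppr_eq0.
  have LMh := LM_bin mem_elim_order c0' ltX.
  have n0 := bin_neq0 c0' (seq_lt_neq ltX).
  have lead : leads (bin X' X) X' by exists X; split=> //; right.
  have [hasG|hasG] := boolP (has (fun f => LTdvd lt f (- c *: bin X' X)) G).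
    exists 0; first apply: div_reduce => //.
      have [fG fX'] := find_leads adm LMh hasG.
      have [W WX' ->] := leads_in XX'.1 fX'.
      rewrite (next_in_inj hPs WX' XX') bin_reduce //; last exact: mem_elim_order.
      by rewrite /bin subrr scaler0; apply: div_zero.
    left; split=> //; have [fG fX'] := find_leads adm LMh hasG.
    have [W WX' e] := leads_in XX'.1 fX'; move: fG.
    by rewrite e (next_in_inj hPs WX' XX').
  exists (- c *: bin X' X); first exact: div_stop.
  by right; split=> //; apply: contra hasG => h; apply: leads_has LMh h lead.
have Y'X' : X' <s Y' by apply: elim_lt_cross QY'; case: XX'.
have YltY' := nxt_lt YY' QY'.
have LMh := LM_bin mem_elim_order c0 Y'X'.
have lead : leads (bin Y' Y) Y'.
  by exists Y; split=> //; left; case/andP: YY'.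
have hasG : has (fun f => LTdvd lt f (c *: bin Y' X')) G.
  by apply: leads_has LMh _ lead; apply: links => //; case/andP: YY'.
have [|r dr hr] := IH; first by move=> _ Z YZ; rewrite (nxt_fun hPs YZ YY').
exists r => //; apply: div_reduce => //; first exact: bin_neq0 c0 (seq_lt_neq Y'X').
have [fG fY'] := find_leads adm LMh hasG.
case: (leads_out QY' fY') => [[W WY' ->]|[W [Y'W QW _]]]; last first.
  by have := out QY' W Y'W; rewrite QW.
rewrite (nxt_inj hPs WY' YY') bin_reduce //; exact: mem_elim_order.
Qed.

(** Two distinct binomials share their leading variable only if it is the last
    atom before some [X'] in [Q] of a stretch outside [Q]; then the S-polynomial
    contributes the binomial [X' - X] jumping over the stretch. *)
Lemma div_Spoly G f h V : admissible G -> all_links G -> f \in G -> h \in G ->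
  leads f V -> leads h V -> f != h ->
  exists X X' r,
    [/\ ~~ Q V, run X V, nxt V X', Q X' & div_es lt G (Spoly lt f h) r /\
     ((r = 0 /\ bin X' X \in G) \/
      [/\ r != 0, (LC lt r)^-1 *: r = bin X' X & bin X' X \notin G])].
Proof.
move=> adm links fG hG fV hV fh.
have QV : ~~ Q V.
  apply: contraNN fh => QV.
  have [U UV ef] := leads_in QV fV; have [W WV eh] := leads_in QV hV.
  by rewrite ef eh (next_in_inj hPs UV WV).
have [X XV] := run_ex wf hPs concl_Q V.
suff main (c : k) X' Y : c != 0 -> nxt V X' -> Q X' -> nxt Y V ->
    Spoly lt f h = c *: bin Y X' -> exists X X' r,
    [/\ ~~ Q V, run X V, nxt V X', Q X' & div_es lt G (Spoly lt f h) r /\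
     ((r = 0 /\ bin X' X \in G) \/
      [/\ r != 0, (LC lt r)^-1 *: r = bin X' X & bin X' X \notin G])].
  have below U : nxt V U -> Q U -> U <s V by move=> _ QU; apply: elim_lt_cross.
  case: (leads_out QV fV) => [[U UV ef]|[U [VU QU ef]]];
  case: (leads_out QV hV) => [[W WV eh]|[W [VW QW eh]]].
  - by rewrite ef eh (nxt_inj hPs UV WV) eqxx in fh.
  - apply: (main (-1) W U) => //; first by rewrite oppr_eq0 oner_eq0.
    rewrite -bin_opp scale1r ef eh Spoly_bin //; last exact: below.
      exact: mem_elim_order.
    exact: nxt_lt.
  - apply: (main 1 U W) => //; first by rewrite oner_eq0.
    rewrite scale1r ef eh Spoly_bin //; last exact: nxt_lt.
      exact: mem_elim_order.
    exact: below.
  - by rewrite ef eh (nxt_fun hPs VU VW) eqxx in fh.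
move=> c0 VX' QX' YV eS.
have XX' : next_in X X' by split=> //; exists V.
have [|r dr hr] := div_run adm links c0 XX' (run_prev hPs XV QV YV).
  by move=> _ Z YZ; rewrite (nxt_fun hPs YZ YV).
exists X, X', r; split=> //; split; first by rewrite eS.
case: hr => [|[-> nG]]; [by left | right].
have ltX := next_in_lt XX'; have c0' : - c != 0 by rewrite oppr_eq0.
rewrite bin_opp LC_bin //; last exact: mem_elim_order.
by split=> //; [exact: bin_neq0 c0' (seq_lt_neq ltX) | rewrite scalerA mulVf // scale1r].
Qed.

(** * The run of the algorithm *)

Lemma binomialsP f :
  reflect (exists U V, [/\ f = bin V U, sim k g U V & U <s V])
    (f \in binomials k s).
Proof.
apply: (iffP allpairsPdep) => [[V [U [_ + ->]]]|[U [V [-> UV lUV]]]].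
  by rewrite mem_filter => /andP[/andP[UV lUV] _]; exists U, V.
by exists V, U; rewrite mem_filter UV lUV !mem_elim_order.
Qed.

Lemma uniq_binomials : uniq (binomials k s).
Proof.
have us : uniq s by exact: uniq_elim_order.
apply: allpairs_uniq_dep => //; first by move=> V _; apply: filter_uniq.
move=> VU VU' /allpairsPdep[V [U [_ h ->]]] /allpairsPdep[V' [U' [_ h' ->]]] /= e.
move: h h'; rewrite !mem_filter => /andP[/andP[_ lUV] _] /andP[/andP[_ lUV'] _].
case: (XvarB_inj (k := k) _ e) => [|[-> ->] //|[eV eU]].
  by rewrite eq_sym (seq_lt_neq lUV).
by case/negP: (seq_lt_asym lUV); rewrite -eV -eU.
Qed.

(** [inv_todo] makes the output complete: a missing binomial has a pair waiting
    for it, so nothing is missing when no pair is left. [inv_new] keeps the added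
    binomials from interfering: their leading variables are in [Q], whereas the
    pairs that matter lead an atom outside [Q]. *)
Record invariant G (B : seq (nat * nat)) : Prop := Invariant {
  inv_new : exists2 N, G = binomials k s ++ N &
    forall f, f \in N -> exists X X', next_in X X' /\ f = bin X' X;
  inv_range : forall i j, (i, j) \in B -> (i < size G)%N && (j < size G)%N;
  inv_todo : forall X V X', run X V -> ~~ Q V -> nxt V X' -> Q X' ->
    bin X' X \in G \/
    exists i j, [/\ (i, j) \in B,
      (i < size (binomials k s))%N && (j < size (binomials k s))%N,
      leads G`_i V, leads G`_j V & G`_i != G`_j]
}.

Lemma next_in_leads X X' : next_in X X' -> leads (bin X' X) X'.
Proof. by move=> h; exists X; split=> //; [apply: next_in_lt | right]. Qed.

Lemma sim_leads U V : sim k g U V -> U <s V -> leads (bin V U) V.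
Proof. by move=> UV lUV; exists U; split=> //; left. Qed.

Lemma inv_admissible G B : invariant G B -> admissible G.
Proof.
case=> -[N -> hN] _ _ f; rewrite mem_cat => /orP[/binomialsP[U [V [-> UV lUV]]]|].
  by exists V; apply: sim_leads.
by case/hN=> X [X' [h ->]]; exists X'; apply: next_in_leads.
Qed.

Lemma inv_links G B : invariant G B -> all_links G.
Proof.
case=> -[N -> hN] _ _ U V UV lUV; rewrite mem_cat; apply/orP; left.
by apply/binomialsP; exists U, V.
Qed.

Lemma leads_Lcm f h V : leads f V -> leads h V -> Lcm lt f h = U_(enum_rank V)%MM.
Proof.
by move=> fV hV; rewrite /Lcm (leads_LM fV) (leads_LM hV) mlcmE submm addm0.
Qed.

Lemma leads_eq_var f h V W : leads f V -> leads h W ->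
  (Lcm lt f h != LM lt f + LM lt h)%MM -> V = W.
Proof.
move=> fV hW; rewrite /Lcm (leads_LM fV) (leads_LM hW) mlcmE.
apply: contraNeq => VW; apply/eqP/mnmP => i; rewrite !mnmDE mnmBE !mnm1E.
case: (enum_rank W =P i) => [<-|_] /=; last by rewrite sub0n.
by rewrite (inj_eq enum_rank_inj) (negbTE VW).
Qed.

(** A stretch outside [Q] creates exactly two binomials with the same leading
    variable, hence no third one to make its pair redundant. *)
Lemma todo_treated G B i j V : invariant G B ->
  (i < size (binomials k s))%N && (j < size (binomials k s))%N ->
  leads G`_i V -> leads G`_j V -> G`_i != G`_j -> ~~ Q V ->
  treated lt G B i j.
Proof.
move=> inv /andP[ltiG0 ltjG0] iV jV ij QV.
rewrite /treated (leads_Lcm iV jV) (leads_LM iV) (leads_LM jV).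
apply/andP; split.
  apply/eqP => /mnmP /(_ (enum_rank V)); rewrite mnmDE XmE eqxx; lia.
apply/negP => /existsP[l /and5P[li lj _ _]].
rewrite (leads_Lcm iV jV).
have [W lW] := inv_admissible inv (mem_nth 0 (ltn_ord l)).
rewrite (leads_LM lW) lepXX => /eqP eW; subst W.
have [[N eG hN] _ _] := inv.
have ltl : (l < size (binomials k s))%N.
  have GN n : (size (binomials k s) <= n)%N -> G`_n = N`_(n - size (binomials k s)).
    by move=> h; rewrite eG nth_cat ltnNge h.
  have sG : size G = (size (binomials k s) + size N)%N by rewrite eG size_cat.
  rewrite ltnNge; apply/negP => le; have hl := leq_trans (ltn_ord l) (eq_leq sG).
  have [|X [X' [XX' e]]] := hN G`_l.
    by rewrite (GN _ le) mem_nth // ltn_subLR.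
  have := leads_LM lW; rewrite e (leads_LM (next_in_leads XX')) => /Xm_inj eV.
  by rewrite -eV XX'.1 in QV.
have two a b c : leads a V -> leads b V -> leads c V -> a != b -> c = a \/ c = b.
  have pred x y : (exists2 U, nxt U V & x = bin V U) ->
      (exists2 U, nxt U V & y = bin V U) -> x = y.
    by case=> U UV -> [U' U'V ->]; rewrite (nxt_inj hPs UV U'V).
  have succ x y : (exists U, [/\ nxt V U, Q U & x = bin V U]) ->
      (exists U, [/\ nxt V U, Q U & y = bin V U]) -> x = y.
    by case=> U [VU _ ->] [U' [VU' _ ->]]; rewrite (nxt_fun hPs VU VU').
  move=> /(leads_out QV)[pa|sa] /(leads_out QV)[pb|sb] /(leads_out QV)[pc|sc] ab;
    first [ by rewrite (pred _ _ pa pb) eqxx in ab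
          | by rewrite (succ _ _ sa sb) eqxx in ab
          | by left; apply: (pred _ _ pc pa) | by left; apply: (succ _ _ sc sa)
          | by right; apply: (pred _ _ pc pb) | by right; apply: (succ _ _ sc sb) ].
have nthG n : (n < size (binomials k s))%N -> G`_n = (binomials k s)`_n.
  by move=> h; rewrite eG nth_cat h.
have eq_nth n : (n < size (binomials k s))%N -> G`_l = G`_n -> l = n :> nat.
  by move=> h; rewrite !nthG // => /eqP; rewrite nth_uniq ?uniq_binomials // => /eqP.
by case: (two _ _ _ iV jV lW ij) => /eq_nth e; [move: li | move: lj]; rewrite e ?eqxx.
Qed.

Lemma lex_first_ex (B : seq (nat * nat)) : B != [::] -> exists i j, lex_first B i j.
Proof.
case: B => // -[i0 j0] B _; set B' := _ :: B.
have exi : exists i, [exists q : seq_sub B', (val q).1 == i].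
  by exists i0; apply/existsP; exists (SeqSub (mem_head _ _)).
case: (ex_minnP exi) => i /existsP[[[i' j'] mem'] /= /eqP ei] mini; subst i'.
have exj : exists j, (i, j) \in B' by exists j'.
case: (ex_minnP exj) => j ij minj; exists i, j; split=> // a b ab.
have : (i <= a)%N by apply: mini; apply/existsP; exists (SeqSub ab).
by rewrite leq_eqVlt => /predU1P[ea|-> //]; subst a; rewrite eqxx minj // orbT.
Qed.

(** By [todo_treated] a skipped pair is responsible for no missing binomial, and
    by [div_Spoly] a treated one supplies its binomial unless it is already
    present. *)
Lemma invariant_step G B i j : invariant G B -> (i, j) \in B ->
  exists r, pair_remainder lt G B i j r /\
    ((r = 0 /\ invariant G [seq q <- B | q != (i, j)]) \/
     exists X X', [/\ r != 0, (LC lt r)^-1 *: r = bin X' X, bin X' X \notin G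
       & invariant (rcons G (bin X' X))
           [seq q <- B ++ [seq (i', size G) | i' <- iota 0 (size G)]
             | q != (i, j)]]).
Proof.
move=> inv ijB; have [[N eG hN] range todo] := inv.
have /andP[ltiG ltjG] := range _ _ ijB.
(* Deleting the pair preserves the invariant as soon as the binomial it is
   responsible for, if any, is present. *)
have keep : (forall X V X', run X V -> ~~ Q V -> nxt V X' -> Q X' ->
     leads G`_i V -> leads G`_j V -> G`_i != G`_j -> treated lt G B i j ->
     bin X' X \in G) -> invariant G [seq q <- B | q != (i, j)].
  move=> done; split; first by exists N.
    by move=> a b; rewrite mem_filter => /andP[_ /range].
  move=> X V X' XV QV VX' QX'; case: (todo X V X' XV QV VX' QX'); first by left.
  case=> a [b [abB lt0 aV bV ab]]; have [e|ne] := eqVneq (a, b) (i, j).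
    move: e aV bV ab lt0 => -[-> ->] iV jV ij lt0; left.
    exact: done XV QV VX' QX' iV jV ij (todo_treated inv lt0 iV jV ij QV).
  by right; exists a, b; rewrite mem_filter ne.
have [tr|ntr] := boolP (treated lt G B i j); last first.
  exists 0; rewrite /pair_remainder (negbTE ntr); split=> //; left; split=> //.
  by apply: keep => X V X' _ _ _ _ _ _ _ h; rewrite h in ntr.
rewrite /pair_remainder tr.
have adm := inv_admissible inv; have links := inv_links inv.
have iG := mem_nth 0 ltiG; have jG := mem_nth 0 ltjG.
have [V iV] := adm _ iG; have [W jW] := adm _ jG.
have eVW : V = W by case/andP: tr => /(leads_eq_var iV jW).
subst W; have [eij|ij] := eqVneq G`_i G`_j.
  exists 0; split; last first.
    by left; split=> //; apply: keep => X V' X' _ _ _ _ _ _; rewrite eij eqxx.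
  by have [U [eU UV _]] := jW; rewrite eij eU Spoly_bin //; [rewrite /bin subrr; apply: div_zero
    | exact: mem_elim_order].
have [X [X' [r [QV XV VX' QX' [dr hr]]]]] :=
  div_Spoly adm links iG jG iV jW ij.
have same X1 V1 X1' : run X1 V1 -> nxt V1 X1' -> leads G`_i V1 -> bin X1' X1 = bin X' X.
  move=> r1 n1 l1; have e : V1 = V by apply: Xm_inj; rewrite -(leads_LM l1) (leads_LM iV).
  by subst V1; rewrite (run_fun hPs r1 XV) (nxt_fun hPs n1 VX').
exists r; split=> //; case: hr => [[r0 inG]|[r0 er nG]].
  left; split=> //; apply: keep => X1 V1 X1' r1 _ n1 _ l1 _ _ _.
  by rewrite (same _ _ _ r1 n1 l1).
right; exists X, X'; split=> //; split.
- exists (rcons N (bin X' X)); first by rewrite eG rcons_cat.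
  move=> f; rewrite mem_rcons inE => /predU1P[->|/hN //].
  by exists X, X'; split=> //; split=> //; exists V.
- move=> a b; rewrite mem_filter mem_cat size_rcons => /andP[_ /orP[/range|]].
    by case/andP=> /leqW ha /leqW hb; apply/andP.
  case/mapP=> c; rewrite mem_iota add0n => /andP[_ hc] [-> ->].
  by rewrite !ltnS leqnn (ltnW hc).
move=> X1 V1 X1' r1 Q1 n1 Q1'; rewrite mem_rcons inE.
case: (todo X1 V1 X1' r1 Q1 n1 Q1') => [->|]; first by left; rewrite orbT.
case=> a [b [abB lt0 aV bV ab]]; have [e|ne] := eqVneq (a, b) (i, j).
  by left; case: e aV => -> _ aV; rewrite (same _ _ _ r1 n1 aV) eqxx.
have size0 n : (n < size (binomials k s))%N -> (n < size G)%N.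
  by move=> h; rewrite eG size_cat ltn_addr.
case/andP: (lt0) => /size0 ha /size0 hb.
by right; exists a, b; rewrite mem_filter mem_cat abB ne !nth_rcons ha hb.
Qed.

(** Each turn removes a pair, and only finitely many binomials can be added. *)
Lemma loop_terminates G B : invariant G B ->
  exists2 H, buch_loop lt G B H & invariant H [::].
Proof.
pose missing G := #|[pred UV : Uat g * Uat g | bin UV.2 UV.1 \notin G]|.
have [n] := ubnP (missing G); elim: n G B => // n IHn G B.
have [m] := ubnP (size B); elim: m B => // m IHm B leB leG inv.
have [B0|B0] := eqVneq B [::].
  by subst B; exists G => //; apply: buch_done.
have [i [j ij]] := lex_first_ex B0.
have [r [hr step]] := invariant_step inv ij.1.
case: step => [[r0 inv']|[X [X' [r0 er nG inv']]]].
  have [|H HB invH] := IHm _ _ leG inv'.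
    rewrite size_filter; apply: leq_trans (leB : (size B <= m)%N).
    rewrite -(count_predC (fun q => q != (i, j)) B) -[X in (X < _)%N]addn0 ltn_add2l.
    rewrite -has_count; apply/hasP; exists (i, j); first exact: ij.1.
    by rewrite /= eqxx.
  by exists H => //; apply: buch_next ij hr _; rewrite r0 eqxx.
have [|H HB invH] := IHn _ _ _ inv'; last first.
  by exists H => //; apply: buch_next ij hr _; rewrite (negbTE r0) er.
apply: leq_trans (leG : (missing G <= n)%N); apply/proper_card/properP; split.
  by apply/subsetP => UV; rewrite !inE mem_rcons inE negb_or => /andP[].
by exists (X, X'); rewrite !inE /= ?mem_rcons ?mem_head.
Qed.

Lemma initial_invariant : invariant (binomials k s)
  [seq (i, j) | j <- iota 0 (size (binomials k s)), i <- iota 0 j].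
Proof.
set G := binomials k s.
have pairs i j : (i < j < size G)%N ->
    (i, j) \in [seq (i, j) | j <- iota 0 (size G), i <- iota 0 j].
  by case/andP=> lij lj; apply/allpairsPdep; exists j, i; rewrite !mem_iota.
split; first by exists [::]; rewrite ?cats0.
  move=> i j /allpairsPdep[b [a [+ + [-> ->]]]]; rewrite !mem_iota !add0n => /= h1 h2.
  by rewrite h1 (ltn_trans h2).
move=> X V X' XV QV VX' QX'; right.
have [Y YV] := prev_ex wf hPs concl_Q QV.
have lX' : X' <s V by exact: elim_lt_cross.
have lY : Y <s V by exact: nxt_lt.
have simY : sim k g Y V by case/andP: YV.
have simX' : sim k g X' V by rewrite simC; case/andP: VX'.
have mY : bin V Y \in G by apply/binomialsP; exists Y, V.
have mX' : bin V X' \in G by apply/binomialsP; exists X', V.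
have neq : bin V Y != bin V X'.
  apply/eqP => /(XvarB_inj (k := k)); rewrite eq_sym (seq_lt_neq lY) => /(_ isT).
  have pX : pos Y <> pos X' 
    by rewrite (nxt_pos VX') (nxt_pos YV); apply/eqP; rewrite neq_ltn ltnS leqnSn.
  case=> [[_ e]|[e _]]; first by rewrite e in pX.
  by move: (seq_lt_neq lY); rewrite -e eqxx.
have todo a b : a \in G -> b \in G -> leads a V -> leads b V -> a != b ->
    (index a G < index b G)%N -> exists i j,
    [/\ (i, j) \in [seq (i, j) | j <- iota 0 (size G), i <- iota 0 j],
      (i < size G)%N && (j < size G)%N, leads G`_i V, leads G`_j V & G`_i != G`_j].
  move=> ma mb la lb ab h; exists (index a G), (index b G).
  rewrite !nth_index //; split=> //; last by rewrite !index_mem ma.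
  by apply: pairs; rewrite h index_mem.
have lead_Y := sim_leads simY lY; have lead_X' := sim_leads simX' lX'.
case: (ltngtP (index (bin V Y) G) (index (bin V X') G)) => h.
- exact: todo mY mX' lead_Y lead_X' neq h.
- by apply: todo mX' mY lead_X' lead_Y _ h; rewrite eq_sym.
- by case/eqP: neq; rewrite -(nth_index 0 mY) h nth_index.
Qed.

Theorem buchberger_elim_order : exists2 H, buchberger_es lt (binomials k s) H
  & admissible H /\ forall X X', next_in X X' -> bin X' X \in H.
Proof.
have [H HB inv] := loop_terminates initial_invariant; exists H => //.
split=> [|X X' XX']; first exact: inv_admissible inv.
have [QX' [V XV VX']] := XX'.
have [QV|QV] := boolP (Q V).
  have eV := run_in XV QV; subst V.
  by apply: inv_links inv _ _ _ (next_in_lt XX'); case/andP: VX'.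
by case: (inv_todo inv XV QV VX' QX') => // -[i [j [+ _]]]; rewrite in_nil.
Qed.

End Elimination.
(** * The surviving binomials *)

Section Survival.
Variables (k : fieldType) (At : Type) (p p' : proof_structure At).
Variable Gam : reduction_seq p p'.
Variables (Ps : seq (seq (Uat p))) (Ps' : seq (seq (Uat p'))).
Hypotheses (hPs : persistent_paths k Ps) (hPs' : persistent_paths k Ps').
Let wf : is_proof_structure p := @ps_wf _ p.
Let wf' : is_proof_structure p' := @ps_wf _ p'.
Let Q : pred (Uat p) := in_image k Gam.
Let rho := seq_U Gam.
Notation next_in := (next_in k Ps Q).

Lemma concl_in_image V : concl_atom V -> Q V.
Proof.
by case/(concl_in_seq Gam) => U <-; rewrite /Q in_imageE; apply: codom_f.
Qed.

Lemma in_image_rho U : Q (rho U).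
Proof. by rewrite /Q in_imageE; apply: codom_f. Qed.

Lemma order_GammaE : order_Gamma k Gam Ps = elim_order Ps Q.
Proof. by rewrite /elim_order !filter_flatten. Qed.

Lemma next_in_concl X Y : next_in X Y ->
  ~~ (concl_atom X && Usign X) /\ ~~ (concl_atom Y && ~~ Usign Y).
Proof.
case=> _ [Z XZ ZY]; split; last by case: (nxt_concl wf hPs ZY).
elim: XZ Y ZY => {Z} [_|Z Z' _ IH ZZ' _] Y ZY; last exact: IH ZZ'.
by case: (nxt_concl wf hPs ZY).
Qed.

(** Along a path of the reduct the images of neighbours are consecutive
    survivors; since the negative end is mapped to a negative end, they come in
    the right order at the beginning of the path, hence everywhere. *)
Lemma nxt_image U V : nxt k Ps' U V -> next_in (rho U) (rho V).
Proof.
have [n] := ubnP (pos Ps' U); elim: n U V => // n IH U V le UV.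
have UneV : U != V by apply: contraTneq UV => ->; rewrite /nxt eqn_leq ltnn andbF andbF.
have simUV : sim k p' U V by case/andP: UV.
have w : walk k Q (rho U) (rho V).
  by apply: sub_walk (seq_walk Gam simUV) => W; rewrite /Q in_imageE.
have rUV : rho U != rho V by rewrite (inj_eq (seq_U_inj (Gam := Gam))).
case: (walk_next_in wf hPs concl_in_image (in_image_rho U) (in_image_rho V) rUV w) => // VU.
case: (concl_or_prev wf' hPs' U) => [negU|[T TU]].
  by case: (next_in_concl VU) => _; rewrite concl_seq Usign_seq negU.
have {}IH := IH T U _ TU; rewrite (nxt_pos TU) ltnS in le.
have eTV : T = V.
  exact: (@seq_U_inj _ _ _ Gam _ _ (next_in_inj hPs (IH le) VU)).
by have := nxt_pos UV; rewrite -eTV (nxt_pos TU) => /eqP; rewrite ltn_eqF // ltnW.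
Qed.

Lemma image_nxt U V : next_in (rho U) (rho V) -> nxt k Ps' U V.
Proof.
move=> rUV; case: (concl_or_next wf' hPs' U) => [posU|[W UW]].
  by case: (next_in_concl rUV); rewrite concl_seq Usign_seq posU.
have := next_in_fun hPs rUV (nxt_image UW) => /seq_U_inj -> //.
Qed.

Lemma binomials0P (h : P_[k] p') :
  reflect (exists U V, h = bin k V U /\ nxt k Ps' U V)
    (h \in binomials k (order0 Ps')).
Proof.
apply: (iffP allpairsPdep) => [[V [U [_ + ->]]]|[U [V [-> UV]]]].
  rewrite mem_filter => /andP[/andP[UV lUV] _]; exists U, V; split=> //.
  case: (sim_pos wf' hPs' UV) => // /nxt_pos e.
  by move: lUV; rewrite /seq_lt -/(pos Ps' U) -/(pos Ps' V) e ltnNge leqnSn.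
exists V, U; rewrite mem_filter /seq_lt -/(pos Ps' U) -/(pos Ps' V) (nxt_pos UV).
by case/andP: UV => -> _; rewrite ltnSn !(mem_flatten_paths hPs').
Qed.

(** Evaluation at the indicator of an atom outside the image agrees with
    evaluation at [0] on the image of the reduct. *)
Lemma bin_Tseq_in U V (h : P_[k] p') : U != V -> bin k V U = Tseq Gam h -> Q V.
Proof.
move=> UV e; apply: contraT; rewrite /Q in_imageE => QV.
have ev (v : Uat p -> k) :
    v V - v U = h.@[fun i => v (rho (enum_val i))].
  by rewrite -meval_Tseq -e mevalB !mevalXU !enum_rankK.
have := ev (fun W => (W == V)%:R); rewrite eqxx (negbTE UV) subr0.
rewrite (_ : h.@[_] = h.@[fun i => (fun=> 0) (rho (enum_val i))]).
  by rewrite -(ev (fun=> 0)) subrr => /eqP; rewrite oner_eq0.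
apply: meval_eq => i; case: eqP => // eV.
by rewrite -eV codom_f in QV.
Qed.

End Survival.

Theorem theorem7p2 (At : Type) (At_infinite : exists f : nat -> At, injective f)
  (k : fieldType) (A : formula At) (p p' : proof_structure At)
  (Gam : reduction_seq p p')
  (net_p : is_proof_net p) (concl_p : single_conclusion p A)
  (net_p' : is_proof_net p') (concl_p' : single_conclusion p' A)
  (Ps : seq (seq (Uat p))) (Ps' : seq (seq (Uat p')))
  (hPs : persistent_paths k Ps) (hPs' : persistent_paths k Ps') :
  exists2 H : seq (P_[k] p),
    buchberger_es (lex_lt (order_Gamma k Gam Ps))
      (binomials k (order_Gamma k Gam Ps)) H
  & forall f : P_[k] p,
      (exists2 h, h \in binomials k (order0 Ps') & f = Tseq Gam h) <->
      (f \in H /\ exists h : P_[k] p', f = Tseq Gam h).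
Proof.
have concl_Q := @concl_in_image k At p p' Gam.
have wf := @ps_wf _ p.
have [H HB [adm new]] := buchberger_elim_order wf hPs concl_Q.
exists H; first by rewrite order_GammaE.
move=> f; split=> [[h /(binomials0P hPs')[U [V [-> UV]]] ->]|[fH [h ef]]].
  split; last by exists (bin k V U).
  by rewrite TseqB !Tseq_Xvar; apply/new/(nxt_image Gam hPs hPs' UV).
have [V fV] := adm f fH.
have UneV U : f = bin k V U -> seq_lt (elim_order Ps (in_image k Gam)) U V ->
    in_image k Gam V.
  by move=> e /seq_lt_neq UV; apply: bin_Tseq_in UV _; rewrite -e ef.
have QV : in_image k Gam V by have [U [e lUV _]] := fV; apply: UneV e lUV.
have [U UV e] := leads_in wf hPs QV fV.
have QU := next_in_start UV; move: QU QV UV e {fV UneV}; rewrite !in_imageE.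
case/codomP=> U' -> /codomP[V' ->] /(image_nxt hPs hPs') UV' e.
exists (bin k V' U'); first by apply/(binomials0P hPs'); exists U', V'.
by rewrite e TseqB !Tseq_Xvar.
Qed.
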